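(* Let $n\ge1$, $\gamma>0$ and let $w$ be any weight on $\mathbb{R}^n$. Say that $w$ satisfies the lower bound property of order $\gamma$ if there exists $C>0$ such that $w(B(x,r))\ge C\,r^\gamma$ for all $x\in\mathbb{R}^n$ and all $0<r\le\frac1{1+|x|_\infty}$. Then the following holds. (a) For any $\alpha_1\le\alpha_2$ and $0<p_1,p_2,q_1,q_2\le\infty$ with $0<q_2\le q_1\le\infty$ and $\alpha_1-\frac{\gamma}{p_1}=\alpha_2-\frac{\gamma}{p_2}$, one has the continuous embedding $b^{p_2,q_2}_{\alpha_2,w}\hookrightarrow b^{p_1,q_1}_{\alpha_1,w}$ if and only if $w$ satisfies the lower bound property of order $\gamma$. (b) If in addition $w\in\mathbb{A}_\infty(\mathcal{L})$, then for any $\alpha_1\le\alpha_2$, $0<p_1,p_2<\infty$ and $0<q_1,q_2\le\infty$ with $\alpha_1-\frac{\gamma}{p_1}=\alpha_2-\frac{\gamma}{p_2}$, one has the continuous embedding $f^{p_2,q_2}_{\alpha_2,w}\hookrightarrow f^{p_1,q_1}_{\alpha_1,w}$ if and only if $w$ satisfies the lower bound property of order $\gamma$.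
   Context: Notation: $|x|_\infty=\max_i|x_i|$; $B(x,r)=\{y:|x-y|<r\}$ is the Euclidean ball; $w(E)=\int_Ew\,dx$; $\mathbf 1_E$ is the indicator of $E$; $\gamma/\infty=0$. A weight is a locally integrable non-negative function on $\mathbb{R}^n$. $\|g\|_{L^p_w}=(\int|g|^pw\,dx)^{1/p}$. A cube $Q$ is axis-parallel with centre $x_Q$ and side-length $\ell(Q)$. $\mathcal{L}=-\Delta+|x|^2$ is the harmonic oscillator on $\mathbb{R}^n$. Tiles. $H_k(t)=(-1)^ke^{t^2}\partial_t^k(e^{-t^2})$ is the $k$th Hermite polynomial. Fix $\delta_\star\in(0,\frac1{37})$ and let $N_j=\lfloor(1+11\delta_\star)(\frac4\pi)^24^j\rfloor+3$ for $j\ge0$. Let $\zeta_{-N_j}<\dots<\zeta_{-1}<0<\zeta_1<\dots<\zeta_{N_j}$ be the zeros of $H_{2N_j}$ (so $\zeta_{-\nu}=-\zeta_\nu$; they depend on $j$). Put $I_1=[0,\frac{\zeta_1+\zeta_2}2]$, $I_\nu=[\frac{\zeta_{\nu-1}+\zeta_\nu}2,\frac{\zeta_\nu+\zeta_{\nu+1}}2]$ for $2\le\nu\le N_j-1$, $I_{N_j}=[\frac{\zeta_{N_j-1}+\zeta_{N_j}}2,\zeta_{N_j}+2^{-j/6}]$ and $I_{-\nu}=-I_\nu$. The tiles of level $j$ are the boxes $R=I_{\nu_1}\times\dots\times I_{\nu_n}$ with $\nu_i\in\{\pm1,\dots,\pm N_j\}$; their collection is $\mathcal{E}_j$, and $\mathcal{E}=\bigcup_{j\ge0}\mathcal{E}_j$.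 Sequence spaces. For $\alpha\in\mathbb{R}$, $0<q\le\infty$, $b^{p,q}_{\alpha,w}$ ($0<p\le\infty$) and $f^{p,q}_{\alpha,w}$ ($0<p<\infty$) consist of all complex sequences $s=\{s_R\}_{R\in\mathcal{E}}$ with, respectively, $$\|s\|_{b^{p,q}_{\alpha,w}}=\Big\{\sum_{j\ge0}2^{j\alpha q}\Big(\sum_{R\in\mathcal{E}_j}\big(w(R)^{1/p}|R|^{-1/2}|s_R|\big)^p\Big)^{q/p}\Big\}^{1/q}<\infty,$$ $$\|s\|_{f^{p,q}_{\alpha,w}}=\Big\|\Big(\sum_{j\ge0}2^{j\alpha q}\sum_{R\in\mathcal{E}_j}\big(\mathbf 1_R|R|^{-1/2}|s_R|\big)^q\Big)^{1/q}\Big\|_{L^p_w}<\infty,$$ with the supremum norm when $q=\infty$ (or $p=\infty$ in the first case, where $w(R)^{1/p}$ is read as $1$). $X\hookrightarrow Y$ means that $X$ embeds continuously into $Y$, i.e. $\|s\|_Y\le C\|s\|_X$ for all $s\in X$, with $C$ independent of $s$. Weight class. Let $\varrho(x)=\frac1{1+|x|_\infty}$ and $\Psi_\theta(Q)=\big(1+\frac{\ell(Q)}{\varrho(x_Q)}\big)^\theta$ for a cube $Q$ and $\theta\ge0$. For $1<p<\infty$, $\eta\ge0$, $\mathbb{A}_p^\eta(\mathcal{L})$ is the set of weights $w$ for which there is $C>0$ with $\big(\frac1{|Q|}\int_Qw\big)^{1/p}\big(\frac1{|Q|}\int_Qw^{1-p'}\big)^{1/p'}\le C\Psi_\eta(Q)$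 for every cube $Q$ ($\frac1p+\frac1{p'}=1$); for $p=1$ the requirement is $\frac1{\Psi_\eta(Q)}\frac1{|Q|}\int_Qw\le w(x)$ for a.e. $x\in Q$ and every cube $Q$. $\mathbb{A}_p(\mathcal{L})=\bigcup_{\eta\ge0}\mathbb{A}_p^\eta(\mathcal{L})$, $\mathbb{A}_\infty(\mathcal{L})=\bigcup_{p\ge1}\mathbb{A}_p(\mathcal{L})$.
   Formalization: The ''only if'' parts assume α1<α2 and, in (a), p1=∞ or positive w-mass on every ball, in (b), w not a.e. zero; the ''if'' part of (b) assumes α1<α2 or q2≤q1; the printed equivalence fails without these. *)

(* Defs.v *)
From HB Require Import structures.
From mathcomp Require Import all_boot all_order all_algebra.
From mathcomp Require Import all_classical all_reals all_analysis.
From mathcomp Require complex.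

Set Implicit Arguments.
Unset Strict Implicit.
Unset Printing Implicit Defensive.

Import Order.TTheory GRing.Theory Num.Theory.
Import numFieldNormedType.Exports.

Local Open Scope classical_set_scope.
Local Open Scope ring_scope.

(* The library has no Lebesgue measure in dimension n: it is built below by
   iterating [lebesgue_measure \x _] and transporting along
   R * R^n ~ R^(n+1).  The sigma-algebra is the Borel one (the product
   sigma-algebra on tuples). *)
Notation Rn R n := (n.-tuple (measurableTypeR R)).

Section lebesgue_Rn.
Context {R : realType}.

Definition tcons n (p : measurableTypeR R * Rn R n) : Rn R n.+1 :=
  [tuple of p.1 :: p.2].

Lemma measurable_tcons n : measurable_fun [set: _] (@tcons n).
Proof. exact: measurable_cons. Qed.

Section step.
Local Open Scope ereal_scope.
Context (n : nat) (mu : {sigma_finite_measure set (Rn R n) -> \bar R}).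

Definition leb_step : set (Rn R n.+1) -> \bar R :=
  pushforward (@lebesgue_measure R \x mu) (@tcons n).

Let preim (A : set (Rn R n.+1)) : measurable A -> measurable (@tcons n @^-1` A).
Proof. by move=> mA; rewrite -[X in measurable X]setTI; exact: measurable_tcons. Qed.

Let leb_step0 : leb_step set0 = 0.
Proof. by rewrite /leb_step /pushforward preimage_set0 measure0. Qed.

Let leb_step_ge0 A : 0 <= leb_step A.
Proof. by rewrite /leb_step /pushforward; exact: measure_ge0. Qed.

Let leb_step_sigma_additive : semi_sigma_additive leb_step.
Proof.
move=> F mF tF mUF; rewrite /leb_step /pushforward preimage_bigcup.
apply: measure_semi_sigma_additive.
- by move=> i; exact: preim.
- apply/trivIsetP => /= i j _ _ ij; rewrite -preimage_setI.
  by move/trivIsetP : tF => /(_ _ _ _ _ ij) ->//; rewrite preimage_set0.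
- by rewrite -preimage_bigcup; exact: preim.
Qed.

HB.instance Definition _ := isMeasure.Build _ _ _ leb_step
  leb_step0 leb_step_ge0 leb_step_sigma_additive.

Let leb_step_sigma_finite : sigma_finite [set: Rn R n.+1] leb_step.
Proof.
have /sigma_finiteP[F [TF ndF Foo]] := sigma_finiteT (@lebesgue_measure R).
have /sigma_finiteP[G [TG ndG Goo]] := sigma_finiteT mu.
pose tsplit (t : Rn R n.+1) : (measurableTypeR R * Rn R n)%type :=
  (thead t, [tuple of behead t]).
have tconsK p : tsplit (tcons p) = p.
  by case: p => x t; rewrite /tsplit /tcons /=; congr pair; exact: val_inj.
have mtsplit : measurable_fun setT tsplit.
  apply/measurable_fun_pairP; split; last exact: measurable_behead.
  exact: measurable_tnth.
exists (fun k => tsplit @^-1` (F k `*` G k)).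
  rewrite -preimage_bigcup -[LHS](preimage_setT tsplit); congr (_ @^-1` _).
  rewrite -setXTT TF TG predeqE => -[x y]; split.
    move=> [/= [i _ Fix] [k _ Gky]]; exists (maxn i k) => //; split.
    - by move: x Fix; exact/subsetPset/ndF/leq_maxl.
    - by move: y Gky; exact/subsetPset/ndG/leq_maxr.
  by move=> [i _ []/= ? ?]; split; exists i.
move=> k; have [? ?] := Foo k; have [? ?] := Goo k; split.
  by rewrite -[X in measurable X]setTI; apply: mtsplit => //; exact: measurableX.
rewrite /leb_step /pushforward.
rewrite (_ : _ @^-1` _ = F k `*` G k).
  by rewrite product_measure1E// lte_mul_pinfty// ge0_fin_numE.
by rewrite -comp_preimage (_ : tsplit \o @tcons n = id)//; apply/funext.
Qed.

HB.instance Definition _ := Measure_isSigmaFinite.Build _ _ _ leb_step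
  leb_step_sigma_finite.

End step.

Fixpoint lebesgue_Rn n : {sigma_finite_measure set (Rn R n) -> \bar R} :=
  match n with
  | 0%N => \d_([tuple] : Rn R 0)
  | m.+1 => leb_step (lebesgue_Rn m)
  end.

End lebesgue_Rn.

Section geometry.
Context {R : realType} {n : nat}.
Implicit Types (x : Rn R n) (E : set (Rn R n)) (w : Rn R n -> R).

Definition sup_norm x : R := \big[Num.max/0]_(i < n) `|tnth x i|.

Definition eball x (r : R) : set (Rn R n) :=
  [set y | Num.sqrt (\sum_(i < n) (tnth x i - tnth y i) ^+ 2) < r].

Definition cube x (l : R) : set (Rn R n) :=
  [set y | forall i, `|tnth y i - tnth x i| <= l / 2].

Definition wmass w E : \bar R := (\int[lebesgue_Rn n]_(x in E) (w x)%:E)%E.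

(* Integrability over all balls is integrability over all compact sets. *)
Definition weight w : Prop :=
  [/\ measurable_fun setT w, forall x, 0 <= w x &
      forall x r, (wmass w (eball x r) < +oo)%E].

Definition lower_bound_property (gamma : R) w : Prop :=
  exists2 C : R, 0 < C & forall x r, 0 < r -> r <= (1 + sup_norm x)^-1 ->
    ((C * r `^ gamma)%:E <= wmass w (eball x r))%E.

Definition rho x : R := (1 + sup_norm x)^-1.

Definition Psi (theta : R) x (l : R) : R := (1 + l / rho x) `^ theta.

Definition average E (f : Rn R n -> \bar R) : \bar R :=
  ((fine (lebesgue_Rn n E))^-1%:E * \int[lebesgue_Rn n]_(x in E) f x)%E.

(* [w ^ (- a)] for a > 0; the library's [0 `^ (- a)] is 0 and not +oo. *)
Definition neg_power w (a : R) x : \bar R :=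
  if w x == 0 then +oo%E else (w x `^ (- a))%:E.

(* For p > 1 one has 1 - p' = - 1 / (p - 1) and 1 / p' = 1 - 1 / p. *)
Definition Ap (eta p : R) w : Prop :=
  weight w /\
  if p == 1 then
    forall c l, 0 < l -> {ae lebesgue_Rn n, forall x, cube c l x ->
      ((Psi eta c l)^-1%:E * average (cube c l) (EFin \o w) <= (w x)%:E)%E}
  else
    exists2 C : R, 0 < C & forall c l, 0 < l ->
      (average (cube c l) (EFin \o w) `^ p^-1 *
       average (cube c l) (neg_power w (p - 1)^-1) `^ (1 - p^-1)
         <= (C * Psi eta c l)%:E)%E.

Definition Ainfty w : Prop :=
  exists p eta : R, [/\ 1 <= p, 0 <= eta & Ap eta p w].

End geometry.

Section hermite_tiles.
Context {R : realType}.

Definition hermite (k : nat) (t : R) : R :=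
  (-1) ^+ k * expR (t ^+ 2) * derive1n k (fun u : R => expR (- u ^+ 2)) t.

(* [z nu], 0 < |nu| <= N, is the increasing enumeration of the zeros of
   H_{2N}, with [z (-1) < 0 < z 1]; the other values of [z] are irrelevant. *)
Definition hermite_zeros (N : nat) (z : int -> R) : Prop :=
  [/\ [set t | hermite N.*2 t = 0] =
        [set z nu | nu in [set nu : int | nu != 0 /\ (`|nu| <= N)%N]],
      forall nu mu : int, nu != 0 -> mu != 0 -> (`|nu| <= N)%N ->
        (`|mu| <= N)%N -> nu < mu -> z nu < z mu
    & z (- 1) < 0 < z 1].

Definition level_size (delta : R) (j : nat) : nat :=
  (Num.truncn ((1 + 11 * delta) * (4 / pi) ^+ 2 * 4 ^+ j) + 3)%N.

(* I_nu for 1 <= nu <= N, with [e] added to the right end of I_N. *)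
Definition mesh (N : nat) (z : int -> R) (e : R) (nu : nat) : set R :=
  [set t | (if nu == 1%N then 0 else (z nu.-1%:Z + z nu%:Z) / 2) <= t
        <= (if nu == N then z N%:Z + e else (z nu%:Z + z nu.+1%:Z) / 2)].

(* A tile of a level with 2N zeros is indexed by its signed indices
   nu_1, ..., nu_n; [(b, k)] stands for nu = k.+1, negated when [b]. *)
Definition tile_index (n N : nat) : Type := {ffun 'I_n -> (bool * 'I_N)%type}.

Definition tile_set n N (z : int -> R) (e : R) (nu : tile_index n N) :
    set (Rn R n) :=
  [set x | forall i, mesh N z e (nu i).2.+1
             (if (nu i).1 then - tnth x i else tnth x i)].

End hermite_tiles.

Section sequence_spaces.
Local Open Scope ereal_scope.
Context {R : realType} (delta : R) (zeta : nat -> int -> R) (n : nat)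
  (w : Rn R n -> R).

Definition level_index (j : nat) := tile_index n (level_size delta j).

Definition tile j (nu : level_index j) : set (Rn R n) :=
  tile_set (zeta j) (2 `^ (- (j%:R / 6)))%R nu.

Definition tile_seq : Type := forall j, level_index j -> complex.complex R.

Definition tile_size j (nu : level_index j) : R :=
  fine (lebesgue_Rn n (tile nu)).

(* |R|^(-1/2) |s_R| *)
Definition coef (s : tile_seq) j (nu : level_index j) : R :=
  (tile_size nu `^ (- 2^-1) * complex.ComplexField.Normc.normc (s j nu))%R.

Definition b_level (p : \bar R) (s : tile_seq) j : \bar R :=
  if p is r%:E then
    (\sum_(nu : level_index j)
       (wmass w (tile nu) `^ r^-1 * (coef s nu)%:E) `^ r) `^ r^-1
  else \big[maxe/0]_(nu : level_index j) (coef s nu)%:E.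

Definition b_norm (alpha : R) (p q : \bar R) (s : tile_seq) : \bar R :=
  if q is r%:E then
    (\sum_(0 <= j <oo)
       (2 `^ (j%:R * alpha * r))%:E * b_level p s j `^ r) `^ r^-1
  else ereal_sup (range (fun j => (2 `^ (j%:R * alpha))%:E * b_level p s j)).

Definition f_fun (alpha : R) (q : \bar R) (s : tile_seq) (x : Rn R n) : \bar R :=
  if q is r%:E then
    (\sum_(0 <= j <oo) (2 `^ (j%:R * alpha * r))%:E *
       \sum_(nu : level_index j) (\1_(tile nu) x * coef s nu)%:E `^ r) `^ r^-1
  else ereal_sup (range (fun j => (2 `^ (j%:R * alpha))%:E *
       \big[maxe/0]_(nu : level_index j) (\1_(tile nu) x * coef s nu)%:E)).

Definition f_norm (alpha p : R) (q : \bar R) (s : tile_seq) : \bar R :=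
  (\int[lebesgue_Rn n]_x (f_fun alpha q s x `^ p * (w x)%:E)) `^ p^-1.

End sequence_spaces.

(* [NX s < +oo] says that [s] belongs to the space with quasi-norm [NX]. *)
Definition embeds {R : realType} {S : Type} (NX NY : S -> \bar R) : Prop :=
  exists2 C : R, 0 < C & forall s, (NX s < +oo -> NY s <= C%:E * NX s)%E.

(* gamma / p, with gamma / oo = 0. *)
Definition div_exponent {R : realType} (gamma : R) (p : \bar R) : R :=
  if p is r%:E then gamma / r else 0.

Arguments b_norm {R} delta zeta {n} w alpha p q s.
Arguments f_norm {R} delta zeta {n} w alpha p q s.

(* Main.v *)
(* The function [H_m(t) exp(-t^2/2)] solves [u'' + (2m + 1 - t^2) u = 0].  Sturm
   comparison with sines shows that the positive zeros of level j are at least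
   a multiple of [2^-j] apart, and that every interval of length [4 2^-j] in
   ]0, 2^j] contains one; the three-term recurrence bounds them by [7 2^j].
   Hence every tile of level j contains a ball of radius about [2^-j] to which
   the lower bound property applies, and every ball B(x, r) with
   r <= 1 / (1 + |x|) contains a tile of a level j with [2^-j] about r: the
   property is equivalent to [w(R) >= c 2^(- j gamma)] for all tiles R.

   This bound is what the embeddings give on one-term sequences, where
   [w(R) > 0] is needed to solve for w(R).  Conversely it yields
   [w(R)^(1/p1) <= C 2^(j (alpha2 - alpha1)) w(R)^(1/p2)], which with the
   monotonicity of l^p norms gives the embedding of the b-spaces.  For the
   f-spaces with alpha1 < alpha2, let g(x) be the integrand of the source norm
   G = ||g||.  Integrating over a single tile bounds the level j part of the
   target integrand at x by
   [min (2^(- j (alpha2 - alpha1)) g(x), C 2^(j gamma / p1) G)], and summing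
   over j gives [C g(x)^(p2/p1) G^(1 - p2/p1)], without maximal functions. *)

Require Import Defs.
From mathcomp Require Import all_boot all_order all_algebra.
From mathcomp Require Import all_classical all_reals all_analysis.
From mathcomp Require Import measurable_realfun.
From mathcomp Require Import ring lra zify.
From mathcomp Require complex.

Set Implicit Arguments.
Unset Strict Implicit.
Unset Printing Implicit Defensive.

Import Order.TTheory GRing.Theory Num.Theory.
Import numFieldNormedType.Exports.

Local Open Scope classical_set_scope.
Local Open Scope ring_scope.

(** * Sturm comparison *)

Section sturm.
Context {R : realType}.
Implicit Types (u du q f : R -> R) (a b k t : R).

(** The second hypothesis makes D order-convex, so by the intermediate value theorem a change of
    sign would put a zero inside D. *)
Lemma nonzero_constant_sign f (D : set R) : continuous f ->
  (forall r s t, D r -> D t -> r <= s <= t -> D s) ->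
  (forall t, D t -> f t != 0) ->
  (forall t, D t -> 0 < f t) \/ (forall t, D t -> f t < 0).
Proof.
move=> cf cD f0.
have [[s Ds fs]|npos] := pselect (exists2 s, D s & f s < 0); last first.
  left => t Dt; rewrite lt_neqAle eq_sym f0//= leNgt; apply/negP => ft.
  by apply: npos; exists t.
right => t Dt; rewrite lt_neqAle f0//= leNgt; apply/negP => ft.
have [st|ts] := leP s t.
  have [|c] := @IVT _ f s t 0 st (continuous_subspaceT cf).
    by rewrite ge_min le_max (ltW fs) (ltW ft) orbT.
  by rewrite in_itv/= => hc /eqP; apply/negP/f0; exact: cD hc.
have [|c] := @IVT _ f t s 0 (ltW ts) (continuous_subspaceT cf).
  by rewrite ge_min le_max (ltW fs) (ltW ft) orbT.
by rewrite in_itv/= => hc /eqP; apply/negP/f0; exact: cD hc.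
Qed.

Variables (u du q : R -> R).
Hypothesis hu : forall t, is_derive t 1 u (du t).
Hypothesis hdu : forall t, is_derive t 1 du (- (q t * u t)).

(** The Wronskian u v' - u' v of u with v(t) = sin (k (t - a)), a solution of v'' + k^2 v = 0. *)
Definition sturm_wronskian k a t :=
  u t * (k * cos (k * (t - a))) - du t * sin (k * (t - a)).

Lemma is_derive_sturm_wronskian k a t :
  is_derive t 1 (sturm_wronskian k a)
    ((q t - k ^+ 2) * u t * sin (k * (t - a))).
Proof.
have hl : is_derive t 1 (fun t => k * (t - a)) k.
  have -> : (fun t => k * (t - a)) = k \*: (id - cst a) by [].
  by apply: is_derive_eq; rewrite subr0 /GRing.scale/= mulr1.
have hs : is_derive t 1 (fun t => sin (k * (t - a))) (cos (k * (t - a)) * k).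
  exact: (@is_derive1_comp _ sin (fun t => k * (t - a))).
have hc : is_derive t 1 (fun t => cos (k * (t - a))) (- sin (k * (t - a)) * k).
  exact: (@is_derive1_comp _ cos (fun t => k * (t - a))).
have -> : sturm_wronskian k a = u * (k \*: (fun t => cos (k * (t - a))))
    - du * (fun t => sin (k * (t - a))) by apply/funext.
apply: is_derive_eq; rewrite /GRing.scale/= -[k *: _]/(k * _). ring.
Qed.

Lemma continuous_sturm_wronskian k a : continuous (sturm_wronskian k a).
Proof.
move=> t; apply: differentiable_continuous; apply/derivable1_diffP.
by have [] := is_derive_sturm_wronskian k a t.
Qed.

Lemma sturm_wronskian_MVT k a s t : s < t ->
  exists2 c, s < c < t & sturm_wronskian k a t - sturm_wronskian k a s =
    (q c - k ^+ 2) * u c * sin (k * (c - a)) * (t - s).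
Proof.
move=> st; have [|c] := MVT st (fun x _ => is_derive_sturm_wronskian k a x).
  exact/continuous_subspaceT/continuous_sturm_wronskian.
by rewrite in_itv/= => hc ->; exists c.
Qed.

(* Otherwise the Wronskian of u and [sin (k (t - a))] would be nondecreasing on
   [a, a + pi / k], while it is positive at the left end and negative at the
   right end. *)
Lemma gt0_interval_lt a b k : 0 < k -> (forall t, a < t < b -> k ^+ 2 <= q t) ->
  (forall t, a <= t <= b -> 0 < u t) -> b - a < pi / k.
Proof.
move=> k0 hq up; rewrite ltNge; apply/negP => kab.
have pk : 0 < pi / k :> R by rewrite divr_gt0 ?pi_gt0.
have akb : a < a + pi / k by lra.
have [c hc] := sturm_wronskian_MVT k a akb.
have -> : sturm_wronskian k a (a + pi / k) = - (u (a + pi / k) * k).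
  have Ek : k * (a + pi / k - a) = pi by field; rewrite gt_eqF.
  by rewrite /sturm_wronskian Ek cospi sinpi; ring.
have -> : sturm_wronskian k a a = u a * k.
  by rewrite /sturm_wronskian subrr mulr0 cos0 sin0; ring.
move=> E.
have := up a; have := up (a + pi / k); move=> h1 h2.
have : 0 < u a * k by rewrite mulr_gt0 ?h2//; lra.
have : 0 < u (a + pi / k) * k by rewrite mulr_gt0 ?h1//; lra.
suff : 0 <= (q c - k ^+ 2) * u c * sin (k * (c - a)) * pi / k.
  by move: E; rewrite (_ : a + pi / k - a = pi / k) ?mulrA; [lra|ring].
rewrite !mulr_ge0 ?pi_ge0 ?invr_ge0 ?(ltW k0)//.
- by rewrite subr_ge0 hq//; lra.
- by rewrite ltW// up//; lra.
- rewrite sin_ge0_pi// mulr_ge0 ?(ltW k0)//=; last lra.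
  by rewrite mulrC -ler_pdivlMr//; lra.
Qed.

(** If b - a were smaller than pi / k, some sine v of frequency k would be positive on [a, b]. The
    quotient u / v vanishes at a and b and is positive between, so its derivative - W / v^2 is
    positive at some c1 and negative at a later c2. Hence W(c1) < 0 < W(c2), whereas W' = (q - k^2)
    u v < 0. *)
Lemma zeros_gap_gt0 a b k : 0 < k -> a < b -> u a = 0 -> u b = 0 ->
  (forall t, a < t < b -> q t < k ^+ 2) ->
  (forall t, a < t < b -> 0 < u t) -> pi / k <= b - a.
Proof.
move=> k0 ab ua ub hq up; rewrite leNgt; apply/negP => kab.
(* The shift makes the comparison sine positive on the closed interval. *)
pose e := (pi / k - (b - a)) / 2; pose s := a - e.
have e0 : 0 < e by rewrite /e; lra.
have sin_pos t : a <= t <= b -> 0 < sin (k * (t - s)).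
  move=> ht; rewrite sin_gt0_pi// mulr_gt0//=; last by rewrite /s; lra.
  by rewrite mulrC -ltr_pdivlMr// /s /e; lra.
pose v t := sin (k * (t - s)).
have hv t : is_derive t 1 v (cos (k * (t - s)) * k).
  have hl : is_derive t 1 (fun t => k * (t - s)) k.
    have -> : (fun t => k * (t - s)) = k \*: (id - cst s) by [].
    by apply: is_derive_eq; rewrite subr0 /GRing.scale/= mulr1.
  exact: (@is_derive1_comp _ sin (fun t => k * (t - s))).
pose f t := u t / v t; pose df t := - sturm_wronskian k s t / v t ^+ 2.
have hf t : a <= t <= b -> is_derive t 1 f (df t).
  move=> ht; have v0 : v t != 0 by rewrite gt_eqF// sin_pos.
  have hV : is_derive t 1 (fun t => (v t)^-1) (- v t ^- 2 *: (cos (k * (t - s)) * k)).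
    exact: is_deriveV.
  have -> : f = u * (fun t => (v t)^-1) by [].
  apply: is_derive_eq; rewrite /GRing.scale/= /df /sturm_wronskian -/(v t).
  by field.
have cf s1 s2 : a <= s1 -> s2 <= b -> {within `[s1, s2], continuous f}.
  move=> h1 h2; apply: derivable_within_continuous => t; rewrite in_itv/= => ht.
  have ht' : a <= t <= b by lra.
  by have [] := hf t ht'.
pose m := (a + b) / 2.
have am : a < m by rewrite /m; lra.
have mb : m < b by rewrite /m; lra.
have fa : f a = 0 by rewrite /f ua mul0r.
have fb : f b = 0 by rewrite /f ub mul0r.
have fm : 0 < f m by rewrite divr_gt0 ?sin_pos ?up//; lra.
have [c hc|c1 hc1 E1] := @MVT _ f df _ _ am _ (cf _ _ (lexx a) (ltW mb)).
  by move: hc; rewrite in_itv/= => hc; apply: hf; lra.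
have [c hc|c2 hc2 E2] := @MVT _ f df _ _ mb _ (cf _ _ (ltW am) (lexx b)).
  by move: hc; rewrite in_itv/= => hc; apply: hf; lra.
move: hc1 hc2; rewrite !in_itv/= => hc1 hc2.
have W1 : sturm_wronskian k s c1 < 0.
  have : 0 < df c1 * (m - a) by lra.
  rewrite /df pmulr_lgt0 ?subr_gt0// pmulr_lgt0 ?oppr_gt0// invr_gt0.
  by rewrite exprn_gt0// sin_pos//; lra.
have W2 : 0 < sturm_wronskian k s c2.
  have : df c2 * (b - m) < 0 by lra.
  rewrite /df mulNr mulNr oppr_lt0 pmulr_lgt0 ?(subr_gt0 m b)// pmulr_lgt0// invr_gt0.
  by rewrite exprn_gt0// sin_pos//; lra.
have [|c hc E] := @sturm_wronskian_MVT k s c1 c2; first lra.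
suff : (q c - k ^+ 2) * u c * sin (k * (c - s)) * (c2 - c1) < 0 by lra.
rewrite pmulr_llt0; last lra.
rewrite pmulr_llt0; last by apply: sin_pos; lra.
rewrite pmulr_llt0; last by apply: up; lra.
by rewrite subr_lt0 hq//; lra.
Qed.

End sturm.

Section sturm_comparison.
Context {R : realType}.
Implicit Types (a b k t : R).
Variables (u du q : R -> R).
Hypothesis hu : forall t : R, is_derive t 1 u (du t).
Hypothesis hdu : forall t : R, is_derive t 1 du (- (q t * u t)).

Let hNu (t : R) : is_derive t 1 (- u : R -> R) (- du t).
Proof. exact: is_deriveN. Qed.
Let hNdu (t : R) : is_derive t 1 (- du : R -> R) (- (q t * (- u) t)).
Proof. by apply: is_derive_eq; rewrite /GRing.opp/= mulrN. Qed.


Let cu : continuous u.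
Proof.
move=> t; apply: differentiable_continuous; apply/derivable1_diffP.
by have [] := hu t.
Qed.

(** Without a zero u has constant sign on [a, b]; the negative case reduces to - u, which solves the
    same equation. *)
Lemma sturm_zero_exists a b k : 0 < k -> pi / k <= b - a ->
  (forall t, a < t < b -> k ^+ 2 <= q t) ->
  exists2 t, a <= t <= b & u t = 0.
Proof.
move=> k0 kab hq; apply: contrapT => nex.
have [r s t hr ht hs|t ht|up|un] :=
    @nonzero_constant_sign _ u [set t | a <= t <= b] cu.
- by move: hr ht hs => /=; lra.
- by apply/eqP => ut; apply: nex; exists t.
- by have := gt0_interval_lt hu hdu k0 hq up; lra.
- have := @gt0_interval_lt _ _ _ _ hNu hNdu a b k k0 hq.
  have H : forall t : R, a <= t <= b -> 0 < (- u) t.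
    by move=> t /un; rewrite /GRing.opp/= oppr_gt0.
  by move=> /(_ H); lra.
Qed.

Lemma sturm_zeros_gap a b k : 0 < k -> a < b -> u a = 0 -> u b = 0 ->
  (forall t, a < t < b -> u t != 0) ->
  (forall t, a < t < b -> q t < k ^+ 2) -> pi / k <= b - a.
Proof.
move=> k0 ab ua ub u0 hq.
have [r s t hr ht hs|t ht|up|un] :=
    @nonzero_constant_sign _ u [set t | a < t < b] cu.
- by move: hr ht hs => /=; lra.
- exact: u0.
- exact: (zeros_gap_gt0 hu hdu).
- apply: (zeros_gap_gt0 hNu hNdu) => //; rewrite ?/GRing.opp/= ?ua ?ub ?oppr0//.
  by move=> t /un; rewrite oppr_gt0.
Qed.

End sturm_comparison.

(** * Hermite polynomials *)

Section hermite_polynomials.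
Context {R : realType}.
Implicit Types (t x : R) (k : nat).

(** The recursion comes from differentiating H_k(t) exp(-t^2); [hermiteE] identifies the values with
    those of [hermite]. *)
Fixpoint hpoly k : {poly R} :=
  if k is k'.+1 then 'X *+ 2 * hpoly k' - (hpoly k')^`() else 1.

Lemma deriv_hpolyS k : (hpoly k.+1)^`() = hpoly k *+ (k.+1).*2.
Proof.
have dX : ('X *+ 2)^`() = 1 *+ 2 :> {poly R} by rewrite derivMn derivX.
elim: k => [|k ih]; first by rewrite /= derivC subr0 mulr1 dX.
rewrite -/hpoly [hpoly k.+2]/= -/(hpoly k.+1) derivB derivM dX ih.
rewrite derivMn [in RHS]doubleS -[in RHS]add2n mulrnDr mulr_natl -addrA.
by congr (_ + _); rewrite mulrnAr -mulrnBl.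
Qed.

Lemma hpoly_rec k : hpoly k.+2 = 'X *+ 2 * hpoly k.+1 - hpoly k *+ (k.+1).*2.
Proof. by rewrite -deriv_hpolyS. Qed.

Lemma gaussian_derivative t :
  is_derive t 1 (fun u : R => expR (- u ^+ 2)) (- (t *+ 2) * expR (- t ^+ 2)).
Proof.
have h : is_derive t 1 (fun u : R => - u ^+ 2) (- (t *+ 2)).
  have -> : (fun u : R => - u ^+ 2) = - (id ^+ 2) by [].
  apply: is_derive_eq; rewrite /GRing.scale/=. ring.
rewrite mulrC; exact: (@is_derive1_comp _ expR (fun u => - u ^+ 2)).
Qed.

Lemma derive1n_gaussian k t : derive1n k (fun u : R => expR (- u ^+ 2)) t =
  (-1) ^+ k * (hpoly k).[t] * expR (- t ^+ 2).
Proof.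
elim: k t => [|k ih] t; first by rewrite derive1n0 /= hornerC expr0 !mul1r.
rewrite derive1nS (_ : derive1n k _ = (-1) ^+ k \*:
    (horner (hpoly k) * (fun u => expR (- u ^+ 2)))); last first.
  by apply/funext => x; rewrite ih -mulrA.
rewrite derive1E; have h := gaussian_derivative t.
rewrite derive_val [hpoly k.+1]/= hornerD hornerN hornerM hornerMn hornerX.
by rewrite /GRing.scale/= [(-1) ^+ k.+1]exprS; ring.
Qed.

Lemma hermiteE k t : hermite k t = (hpoly k).[t].
Proof.
rewrite /hermite derive1n_gaussian; have := expRxMexpNx_1 (t ^+ 2).
set a := expR (t ^+ 2); set b := expR (- t ^+ 2) => E.
rewrite [LHS](_ : _ = ((-1) ^+ k * (-1) ^+ k) * (hpoly k).[t] * (a * b)); last by ring.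
by rewrite E mulr1 -expr2 sqrr_sign mul1r.
Qed.

(** The ratio bound makes the induction work: 2 (m + 1) H_m <= t^2 H_m <= t H_{m+1}, so the
    recurrence leaves H_{m+2} >= 2 t H_{m+1} - t H_{m+1}. The consequence is t^2 < 2 m for positive
    zeros of H_m. *)
Lemma hpoly_gt0 m t : 0 < t -> m.*2%:R <= t ^+ 2 ->
  0 < (hpoly m).[t] /\ t * (hpoly m).[t] <= (hpoly m.+1).[t].
Proof.
move=> t0; elim: m => [|m ih] mt.
  by rewrite /= derivC subr0 mulr1 !hornerE; split => //; lra.
have [|h1 h2] := ih; first by apply: le_trans mt; rewrite ler_nat; lia.
have h3 : 0 < (hpoly m.+1).[t] by apply: lt_le_trans h2; rewrite mulr_gt0.
split=> //; rewrite hpoly_rec.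
move: (hpoly m) (hpoly m.+1) h1 h2 h3 => A B h1 h2 h3.
rewrite hornerD hornerN hornerM !hornerMn hornerX.
set a := A.[t] in h1 h2 *; set b := B.[t] in h2 h3 *.
suff : a *+ m.+1.*2 <= t * b by rewrite mulr2n; lra.
apply: le_trans (_ : t * (t * a) <= _); last by rewrite ler_pM2l.
by rewrite mulrA -expr2 -mulr_natl ler_pM2r.
Qed.

Definition hermite_fun k t := (hpoly k).[t] * expR (- t ^+ 2 / 2).

Lemma hermite_fun_eq0 k t : hermite_fun k t = 0 <-> hermite k t = 0.
Proof.
rewrite hermiteE /hermite_fun; split=> [/eqP|->]; last by rewrite mul0r.
by rewrite mulf_eq0 (gt_eqF (expR_gt0 _)) orbF => /eqP.
Qed.

Definition hermite_fun' k t :=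
  ((hpoly k)^`().[t] - t * (hpoly k).[t]) * expR (- t ^+ 2 / 2).

Let half_gaussian t :
  is_derive t 1 (fun u : R => expR (- u ^+ 2 / 2)) (expR (- t ^+ 2 / 2) * - t).
Proof.
have h : is_derive t 1 (fun u : R => - u ^+ 2 / 2) (- t).
  have -> : (fun u : R => - u ^+ 2 / 2) = - (2^-1 \*: (id ^+ 2)).
    by apply/funext => u; rewrite mulNr mulrC.
  by apply: is_derive_eq; rewrite /GRing.scale/=; field.
exact: (@is_derive1_comp _ expR (fun u : R => - u ^+ 2 / 2)).
Qed.

Lemma is_derive_hermite_fun k t : is_derive t 1 (hermite_fun k) (hermite_fun' k t).
Proof.
have h := half_gaussian t.
have -> : hermite_fun k = horner (hpoly k) * (fun u => expR (- u ^+ 2 / 2)).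
  by apply/funext.
apply: is_derive_eq; rewrite /GRing.scale/= /hermite_fun'; ring.
Qed.

Lemma is_derive_hermite_fun' k t : is_derive t 1 (hermite_fun' k)
  (- ((k.*2.+1%:R - t ^+ 2) * hermite_fun k t)).
Proof.
have h := half_gaussian t.
(* Hermite's equation H'' = 2 t H' - 2 k H, from equating two expressions for the derivative of
   H_{k+1}. *)
have E : (hpoly k)^`()^`() = 'X *+ 2 * (hpoly k)^`() - hpoly k *+ k.*2.
  have := deriv_hpolyS k; rewrite [hpoly k.+1]/= derivB derivM derivMn derivX.
  rewrite [k.+1.*2]doubleS -[k.*2.+2]add2n mulrnDr mulr_natl -addrA => /addrI <-.
  by rewrite opprB addrC subrK.
rewrite /hermite_fun' /hermite_fun; move: (hpoly k) E => A E.
pose B := A^`() - 'X * A.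
have BE u : B.[u] = A^`().[u] - u * A.[u].
  by rewrite /B hornerD hornerN hornerM hornerX.
have -> : (fun u => (A^`().[u] - u * A.[u]) * expR (- u ^+ 2 / 2)) =
    horner B * (fun u => expR (- u ^+ 2 / 2)).
  by apply/funext => u; rewrite -BE.
apply: is_derive_eq; rewrite BE {1}/B derivB derivM derivX E mul1r.
rewrite /GRing.scale/= hornerD hornerN hornerD hornerN hornerD.
rewrite !hornerM !hornerMn hornerX.
rewrite -[A.[t] *+ _]mulr_natl; ring.
Qed.

Lemma hermite_zero_lt m t : 0 < t -> hermite m t = 0 -> t ^+ 2 < m.*2%:R.
Proof.
move=> t0; rewrite hermiteE ltNge => ht; apply/negP => /(hpoly_gt0 t0)[].
by rewrite ht ltxx.
Qed.

Lemma hermite_zero_exists m (a b k : R) : 0 < k -> pi / k <= b - a ->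
  (forall t, a < t < b -> k ^+ 2 <= m.*2.+1%:R - t ^+ 2) ->
  exists2 t, a <= t <= b & hermite m t = 0.
Proof.
move=> k0 kab hq.
have [t tab /hermite_fun_eq0 ht] := sturm_zero_exists
  (is_derive_hermite_fun m) (is_derive_hermite_fun' m) k0 kab hq.
by exists t.
Qed.

Lemma hermite_zeros_gap m (a b k : R) : 0 < k -> a < b ->
  hermite m a = 0 -> hermite m b = 0 ->
  (forall t, a < t < b -> hermite m t != 0) ->
  m.*2.+1%:R < k ^+ 2 -> pi / k <= b - a.
Proof.
move=> k0 ab /hermite_fun_eq0 ha /hermite_fun_eq0 hb h0 mk.
apply: (sturm_zeros_gap (is_derive_hermite_fun m) (is_derive_hermite_fun' m)) => //.
  by move=> t /h0; apply: contra_neq => /hermite_fun_eq0.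
by move=> t _; rewrite (le_lt_trans _ mk)// gerBl sqr_ge0.
Qed.

End hermite_polynomials.

(** * Hermite zeros of a level *)

Section level_zeros.
Context {R : realType} (delta : R) (zeta : nat -> int -> R).
Hypothesis hzeta : forall j, hermite_zeros (level_size delta j) (zeta j).
Implicit Types (j nu : nat) (t : R).
Local Notation N := (level_size delta).

Lemma level_size_ge3 j : (3 <= N j)%N.
Proof. by rewrite /level_size leq_addl. Qed.

Lemma zeta_zero j nu : (0 < nu <= N j)%N -> hermite (N j).*2 (zeta j nu) = 0.
Proof.
move=> /andP[h0 h1]; have [h _ _] := hzeta j.
have : [set t | hermite (N j).*2 t = 0] (zeta j nu).
  by rewrite h; exists (nu : int) => //; split => //; rewrite eqz_nat -lt0n.
by [].
Qed.

Lemma zeta_lt j nu mu : (0 < nu)%N -> (nu < mu)%N -> (mu <= N j)%N ->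
  zeta j nu < zeta j mu.
Proof.
move=> h0 h1 h2; have [_ h _] := hzeta j.
by apply: h => //; rewrite ?eqz_nat ?absz_nat; lia.
Qed.

Lemma zeta_gt0 j nu : (0 < nu <= N j)%N -> 0 < zeta j nu.
Proof.
move=> /andP[h0 h1]; have [_ _ /andP[_ h]] := hzeta j.
case: nu h0 h1 => // -[|nu] _ h1; first exact: h.
by apply: lt_trans h _; exact: zeta_lt.
Qed.

Lemma zeta_exists j t : 0 < t -> hermite (N j).*2 t = 0 ->
  exists2 nu, (0 < nu <= N j)%N & t = zeta j nu.
Proof.
move=> t0 ht; have [h lt_z z1] := hzeta j.
have : [set t | hermite (N j).*2 t = 0] t by [].
rewrite h => -[[nu|nu] /= [nu0 nuN] tE].
  by exists nu => //; rewrite nuN andbT lt0n -eqz_nat.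
(* A negative index would put the positive t at or below the negative zero of index -1. *)
have N3 := level_size_ge3 j; suff : t <= zeta j (- 1) by lra.
rewrite -tE; case: nu nu0 nuN {tE} => [|nu] nu0 nuN //.
by apply/ltW/lt_z => //; lia.
Qed.

Hypothesis hdelta : 0 < delta < 37^-1.

(** The factor (1 + 11 delta) (4 / pi)^2 lies in [1, 8]; truncation and the added 3 turn these
    bounds into 1 and 11. *)
Lemma level_size_bounds j :
  (4 ^+ j <= (N j)%:R :> R) /\ ((N j)%:R <= 11 * 4 ^+ j :> R).
Proof.
rewrite /level_size natrD; set y := _ * 4 ^+ j.
have f1 : 1 <= 4 ^+ j :> R by rewrite exprn_ege1 ?ler1n.
have p4 : 1 < 4 / pi :> R.
  by rewrite ltr_pdivlMr ?pi_gt0// mul1r; have := @pihalf_lt2 R; lra.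
have p2 : 4 / pi <= 2 :> R.
  by rewrite ler_pdivrMr ?pi_gt0//; have := @pi_ge2 R; lra.
have P1 : 1 <= (4 / pi) ^+ 2 :> R by rewrite exprn_ege1// ltW.
have P4 : (4 / pi) ^+ 2 <= 4 :> R.
  by rewrite expr2; move: p4 p2; set X := 4 / pi; nra.
have /andP[A1 A8] : 1 <= (1 + 11 * delta) * (4 / pi) ^+ 2 <= 8.
  move: P1 P4; set P := (_ / pi) ^+ 2 => P1 P4; move: hdelta => /andP[d0 d1].
  have d2 : delta < 1 / 11 by lra.
  by apply/andP; split; nra.
have y0 : 4 ^+ j <= y by rewrite /y ler_peMl//; lra.
have y1 : y <= 8 * 4 ^+ j by rewrite /y ler_wpM2r//; lra.
have /andP[h1 h2] : (Num.truncn y)%:R <= y < (Num.truncn y).+1%:R.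
  by apply: truncn_itv; lra.
rewrite -natr1 in h2.
by split; lra.
Qed.

(** A zero t of H_{2N} has t^2 < 4 N <= 44 4^j, which is below (7 2^j)^2. *)
Lemma zeta_le j nu : (0 < nu <= N j)%N -> zeta j nu <= 7 * 2 ^+ j.
Proof.
move=> hnu; have := hermite_zero_lt (zeta_gt0 hnu) (zeta_zero hnu).
have [_ hN] := level_size_bounds j.
have -> : (N j).*2.*2 = (4 * N j)%N by lia.
rewrite natrM => h; have z0 := zeta_gt0 hnu.
rewrite -(@ler_pXn2r _ 2) ?nnegrE ?mulr_ge0 ?exprn_ge0 ?(ltW z0)//.
apply: ltW; apply: lt_le_trans h _.
rewrite exprMn -exprM mulnC exprM (_ : 2 ^+ 2 = 4); last by ring.
have : 0 <= 4 ^+ j :> R by rewrite exprn_ge0.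
lra.
Qed.

(** Comparison with frequency k = 7 2^j: the potential is at most 4 N + 1 <= 45 4^j < k^2, and pi >=
    2. *)
Lemma zeta_gap j nu : (0 < nu < N j)%N ->
  2 / (7 * 2 ^+ j) <= zeta j nu.+1 - zeta j nu.
Proof.
move=> hnu; have k0 : 0 < 7 * 2 ^+ j :> R by rewrite mulr_gt0 ?exprn_gt0.
have hz m : m = nu \/ m = nu.+1 -> (0 < m <= N j)%N by lia.
apply: le_trans (_ : pi / (7 * 2 ^+ j) <= _).
  by rewrite ler_pM2r ?invr_gt0// pi_ge2.
apply: (@hermite_zeros_gap _ (N j).*2) => //.
- by apply: zeta_lt => //; lia.
- by apply/zeta_zero/hz; left.
- by apply/zeta_zero/hz; right.
(* A zero in between would carry an index strictly between nu and nu + 1. *)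
- move=> t /andP[t1 t2]; apply/eqP => ht.
  have t0 : 0 < t by apply: lt_trans t1; apply/zeta_gt0/hz; left.
  have [mu hmu tE] := zeta_exists t0 ht; rewrite tE in t1 t2.
  have [mn|nm] := leqP mu nu.
    move: t1; rewrite ltNge => /negP; apply; move: mn.
    by rewrite leq_eqVlt => /predU1P[->//|mn]; apply/ltW/zeta_lt => //; lia.
  move: t2; rewrite ltNge => /negP; apply; move: nm.
  by rewrite leq_eqVlt => /predU1P[->//|mn]; apply/ltW/zeta_lt => //; lia.
- have [h1 h2] := level_size_bounds j.
  rewrite exprMn -exprM [(j * 2)%N]mulnC exprM (_ : 2 ^+ 2 = 4); last by ring.
  have -> : (N j).*2.*2.+1 = (4 * N j + 1)%N by lia.
  rewrite natrD natrM.
  have : 1 <= 4 ^+ j :> R by rewrite exprn_ege1 ?ler1n.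
  lra.
Qed.

(** Comparison with frequency k = 2^j: for t <= 2^j the potential 4 N + 1 - t^2 is at least 3 4^j >=
    k^2, and pi < 4. *)
Lemma zeta_dense j a : 0 < a -> a + 4 / 2 ^+ j <= 2 ^+ j ->
  exists2 nu, (0 < nu <= N j)%N & a <= zeta j nu <= a + 4 / 2 ^+ j.
Proof.
move=> a0 ha; have k0 : 0 < 2 ^+ j :> R by rewrite exprn_gt0.
have [||t hat ht] := @hermite_zero_exists _ (N j).*2 a (a + 4 / 2 ^+ j) (2 ^+ j) k0.
- rewrite addrAC subrr add0r ler_pM2r ?invr_gt0//.
  by have := @pihalf_lt2 R; lra.
- move=> t ht; have : t ^+ 2 <= (2 ^+ j) ^+ 2.
    by rewrite ler_pXn2r ?nnegrE//; lra.
  rewrite -exprM [(j * 2)%N]mulnC exprM (_ : 2 ^+ 2 = 4); last by ring.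
  have -> : (N j).*2.*2.+1 = (4 * N j + 1)%N by lia.
  by rewrite natrD natrM; have [h1 h2] := level_size_bounds j; lra.
have [|nu hnu E] := zeta_exists _ ht; first by lra.
by exists nu; rewrite // -E.
Qed.

End level_zeros.

(** * Balls and boxes *)

Section euclidean_balls.
Context {R : realType} {n : nat}.
Implicit Types (x y : Rn R n) (r d : R).

Lemma eball_coord x r y i : eball x r y -> `|tnth x i - tnth y i| < r.
Proof.
rewrite /eball/=; apply: le_lt_trans.
rewrite -sqrtr_sqr ler_sqrt (bigD1 i)//=.
  by rewrite lerDl sumr_ge0// => k _; rewrite sqr_ge0.
by rewrite addr_ge0 ?sqr_ge0// sumr_ge0// => k _; rewrite sqr_ge0.
Qed.

Lemma eball_box x r d y : 0 < r -> n%:R * d < r ->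
  (forall i, `|tnth x i - tnth y i| <= d) -> eball x r y.
Proof.
move=> r0 dr hd; rewrite /eball/=.
(* For n = 0 the distance is 0; otherwise a coordinate gives [0 <= d], and n d^2 <= (n d)^2. *)
have [i|n0] := pickP (fun i : 'I_n => true); last first.
  rewrite big1 ?sqrtr0// => i _.
  by have := n0 i.
move=> _; have d0 : 0 <= d := le_trans (normr_ge0 _) (hd i).
have nd : 0 <= n%:R * d by rewrite mulr_ge0.
rewrite -(ger0_norm (ltW r0)) -sqrtr_sqr ltr_sqrt ?exprn_gt0//.
apply: (@le_lt_trans _ _ ((n%:R * d) ^+ 2)); last first.
  by rewrite ltr_pXn2r// nnegrE ltW.
apply: (@le_trans _ _ (\sum_(k < n) d ^+ 2)).
  by apply: ler_sum => k _; rewrite -real_normK ?num_real// ler_pXn2r// nnegrE.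
rewrite sumr_const card_ord -[leLHS]mulr_natl exprMn ler_wpM2r ?sqr_ge0//.
by rewrite expr2 -natrM ler_nat; have := ltn_ord i; nia.
Qed.

Lemma sup_norm_ge x i : `|tnth x i| <= sup_norm x.
Proof. exact: (@le_bigmax _ _ _ 0 (fun i => `|tnth x i|) i). Qed.

Lemma sup_norm_ge0 x : 0 <= sup_norm x.
Proof. exact: bigmax_ge_id. Qed.

Lemma sup_norm_le x r : 0 <= r -> (forall i, `|tnth x i| <= r) -> sup_norm x <= r.
Proof. by move=> r0 h; apply: bigmax_le. Qed.

Lemma measurable_eball x r : measurable (eball x r).
Proof.
pose f y := Num.sqrt (\sum_(i < n) (tnth x i - tnth y i) ^+ 2).
have mf : measurable_fun setT f.
  have ms : measurable_fun [set: R] (fun t : R => Num.sqrt t).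
    by apply: continuous_measurable_fun; exact: sqrt_continuous.
  apply: (measurableT_comp ms).
  apply: (@measurable_sum _ _ _ _ _ _
    (fun i (y : Rn R n) => (tnth x i - tnth y i) ^+ 2)) => i.
  apply: measurable_funX.
  by apply: measurable_funB => //; exact: measurable_tnth.
rewrite (_ : eball x r = setT `&` f @^-1` `]-oo, r[%classic).
  exact: mf.
by rewrite setTI; apply/seteqP; split => y; rewrite /eball/= in_itv.
Qed.

Lemma measurable_box (B : 'I_n -> set R) : (forall i, measurable (B i)) ->
  measurable [set y : Rn R n | forall i, B i (tnth y i)].
Proof.
move=> mB; rewrite (_ : mkset _ = \bigcap_(i in setT) ((@tnth _ _)^~ i @^-1` B i)).
  apply: fin_bigcap_measurable; first exact: finite_finset.
  move=> i _; rewrite -[X in measurable X]setTI.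
  exact: (@measurable_tnth _ (measurableTypeR R) n i measurableT _ (mB i)).
by apply/seteqP; split => [y h i _|y h i]; [exact: h|exact: (h i I)].
Qed.

End euclidean_balls.

(** * Lebesgue measure of boxes and cubes *)

Section box_measure.
Context {R : realType}.
Local Open Scope ereal_scope.

(** Induction along the construction of the measure: the preimage of a box under [tcons] is its
    first side times a box of one dimension less. *)
Lemma lebesgue_Rn_box n (B : 'I_n -> set R) : (forall i, measurable (B i)) ->
  (forall i, 0 < lebesgue_measure (B i) < +oo) ->
  0 < lebesgue_Rn n [set y : Rn R n | forall i, B i (tnth y i)] < +oo.
Proof.
elim: n B => [|n ih] B mB B0 /=.
  rewrite diracE mem_set ?lte01 ?ltry//.
  by move=> -[].
rewrite /leb_step /pushforward.
rewrite (_ : _ @^-1` _ =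
    B ord0 `*` [set y : Rn R n | forall i, B (lift ord0 i) (tnth y i)]).
  have mY := @measurable_box R n _ (fun i => mB (lift ord0 i)).
  rewrite product_measure1E//; last exact: mB.
  have /andP[h1 h2] := B0 ord0.
  have /andP[h3 h4] := ih _ (fun i => mB (lift ord0 i)) (fun i => B0 (lift ord0 i)).
  by rewrite mule_gt0//= lte_mul_pinfty// ?(ltW h1)// ge0_fin_numE// ltW.
apply/seteqP; split => -[t y] /=.
  move=> h; split; first exact: (h ord0).
  by move=> i; have := h (lift ord0 i); rewrite /tcons (tnthS t).
move=> [h1 h2] i; have [k ->|->] := unliftP ord0 i.
  by rewrite /tcons (tnthS t); exact: h2.
by [].
Qed.

Lemma lebesgue_Rn_cube n (c : Rn R n) (l : R) : (0 < l)%R ->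
  0 < lebesgue_Rn n (cube c l) < +oo.
Proof.
move=> l0; rewrite (_ : cube c l = [set y : Rn R n | forall i,
    `[(tnth c i - l / 2), (tnth c i + l / 2)]%classic (tnth y i)]%R).
  apply: (@lebesgue_Rn_box n (fun i =>
    `[(tnth c i - l / 2), (tnth c i + l / 2)]%classic)%R) => i.
    exact: measurable_itv.
  rewrite lebesgue_measure_itv/= lte_fin ifT; last lra.
  by rewrite -EFinD lte_fin ltry andbT; lra.
by apply/seteqP; split => y /= h i; have := h i; rewrite /= in_itv/= ler_distl.
Qed.

Lemma measurable_cube n (c : Rn R n) (l : R) : measurable (cube c l).
Proof.
rewrite (_ : cube c l = [set y : Rn R n | forall i,
    `[(tnth c i - l / 2), (tnth c i + l / 2)]%classic (tnth y i)]%R).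
  apply: (@measurable_box R n (fun i =>
    `[(tnth c i - l / 2), (tnth c i + l / 2)]%classic)%R) => i.
  exact: measurable_itv.
by apply/seteqP; split => y /= h i; have := h i; rewrite /= in_itv/= ler_distl.
Qed.

End box_measure.

(** * Cells *)

Section tiles.
Context {R : realType} (delta : R) (zeta : nat -> int -> R).
Hypothesis hdelta : 0 < delta < 37^-1.
Hypothesis hzeta : forall j, hermite_zeros (level_size delta j) (zeta j).
Implicit Types (j nu k : nat) (t : R).
Local Notation N := (level_size delta).
Local Notation cell j := (mesh (N j) (zeta j) (2 `^ (- (j%:R / 6)))).

Let zlt := zeta_lt hzeta.
Let zgt0 := zeta_gt0 hzeta.
Let zgap := zeta_gap hzeta hdelta.
Let zle := zeta_le hzeta hdelta.

(** With r = 1 / (14 2^j) consecutive zeros are at least 4 r apart. So an interval of length 2 r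
    fits between the left midpoint and the zero of index nu, and for nu = 1 it is [0, 2 r]. *)
Lemma cell_contains_interval j nu : (0 < nu <= N j)%N ->
  exists2 c, 0 <= c <= 7 * 2 ^+ j &
    forall t, `|t - c| < (14 * 2 ^+ j)^-1 -> cell j nu t.
Proof.
move=> hnu; have N3 := level_size_ge3 delta j.
have g1 : (0 < 1 < N j)%N by rewrite (leq_trans _ N3).
have g1' : (0 < 1 <= N j)%N by rewrite (leq_trans _ N3).
have pj : 1 <= 2 ^+ j :> R by rewrite exprn_ege1 ?ler1n.
set r := (14 * 2 ^+ j)^-1; have r0 : 0 < r by rewrite invr_gt0; lra.
have rE : 2 / (7 * 2 ^+ j) = 4 * r by rewrite /r; field; lra.
have r1 : r <= 1 by rewrite invf_le1; lra.
have e0 : 0 < 2 `^ (- (j%:R / 6)) :> R by rewrite powR_gt0.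
have [nu1|nu1] := eqVneq nu 1%N.
  exists r; first by apply/andP; split; lra.
  move=> t; rewrite ltr_distl subrr => ht.
  rewrite /mesh/= nu1 eqxx ifF; last by apply/negbTE; rewrite neq_ltn (leq_trans _ N3).
  by have := zgap g1; rewrite rE; have := zgt0 g1'; lra.
have nu2 : (1 < nu)%N by move/andP : hnu => [h _]; rewrite ltn_neqAle eq_sym nu1.
have g2 : (0 < nu.-1 < N j)%N.
  by rewrite -subn1 subn_gt0 nu2 subn1 prednK ?(ltnW nu2)//; move/andP : hnu => [].
have g2' : (0 < nu.-1 <= N j)%N by move/andP : g2 => [-> /ltnW ->].
have gap1 := zgap g2; rewrite prednK ?(ltnW nu2)// rE in gap1.
have z1 := zgt0 g2'; have z2 := zle hnu.
exists ((zeta j nu.-1 + zeta j nu) / 2 + r); first by apply/andP; split; lra.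
move=> t; rewrite ltr_distl => ht; rewrite /mesh/= (negbTE nu1).
case: eqVneq => [<-|nuN']; first by lra.
have g3 : (0 < nu < N j)%N by move/andP : hnu => [-> h]; rewrite ltn_neqAle nuN'.
by have := zgap g3; rewrite rE; lra.
Qed.

Let zmono j nu mu : (0 < nu)%N -> (nu <= mu)%N -> (mu <= N j)%N ->
  zeta j nu <= zeta j mu.
Proof.
by move=> m0; rewrite leq_eqVlt => /predU1P[->//|m12 m2]; apply/ltW/zlt.
Qed.

(* The interval contains three zeros, and the cell of the middle one lies
   between the outer two. *)
Lemma cell_in_interval j a : 0 <= a -> a + 16 / 2 ^+ j <= 2 ^+ j ->
  exists2 nu, (0 < nu <= N j)%N &
    forall t, cell j nu t -> a <= t <= a + 16 / 2 ^+ j.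
Proof.
move=> a0; set d := (2 ^+ j)^-1 => ha; have d0 : 0 < d by rewrite invr_gt0 exprn_gt0.
have zd := zeta_dense hzeta hdelta.
(* The windows [a + d, a + 5 d], [a + 6 d, a + 10 d], [a + 11 d, a + 15 d] are disjoint and have the
   length 4 d required by [zeta_dense]. *)
have [||nu1 /andP[p1 h1] z1] := zd j (a + d); [lra|rewrite -/d; lra|].
have [||nu2 /andP[p2 h2] z2] := zd j (a + 6 * d); [lra|rewrite -/d; lra|].
have [||nu3 /andP[p3 h3] z3] := zd j (a + 11 * d); [lra|rewrite -/d; lra|].
rewrite -/d in z1 z2 z3.
have o12 : (nu1 < nu2)%N by rewrite ltnNge; apply/negP => /zmono -/(_ _ p2 h1); lra.
have o23 : (nu2 < nu3)%N by rewrite ltnNge; apply/negP => /zmono -/(_ _ p3 h2); lra.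
exists nu2 => [|t]; first by rewrite p2.
have o12' : (nu1 <= nu2.-1)%N by rewrite -ltnS prednK.
rewrite /mesh/= !ifF; last 2 first.
- by apply/negbTE; rewrite neq_ltn (leq_trans o23 h3).
- by apply/negbTE; rewrite neq_ltn orbC (leq_trans _ o12).
have w1 := zmono p1 o12' (leq_trans (leq_pred _) h2).
have w2 := zmono (ltn0Sn nu2) o23 h3.
have w3 := zmono (leq_trans p1 o12') (leq_pred _) h2.
have w4 := zmono p2 (leqnSn _) (leq_trans o23 h3).
lra.
Qed.

(** Neighbouring cells share an end point. Distinct indices of equal parity differ by at least 2,
    and such cells are disjoint. *)
Lemma cell_inj j nu mu t : (0 < nu <= N j)%N -> (0 < mu <= N j)%N ->
  cell j nu t -> cell j mu t -> odd nu = odd mu -> nu = mu.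
Proof.
wlog: nu mu / (nu <= mu)%N => [hw|] .
  have [nm|mn] := leqP nu mu; first exact: hw.
  by move=> h1 h2 h3 h4 h5; apply/esym/hw => //; exact: ltnW.
rewrite leq_eqVlt => /predU1P[->//|nm] /andP[nu0 _] /andP[_ muN] h1 h2 odd_nm.
have nm2 : (nu.+1 < mu)%N.
  by rewrite ltn_neqAle nm andbT; apply/eqP => E; move: odd_nm; rewrite -E /=; case: odd.
have nm3 : (nu.+1 <= mu.-1)%N by rewrite -ltnS (ltn_predK nm).
exfalso; move: h1 h2; rewrite /mesh/=.
have -> : (nu == N j) = false by apply/negbTE; rewrite neq_ltn (leq_trans nm muN).
have -> : (mu == 1%N) = false by apply/negbTE; rewrite neq_ltn (leq_trans _ nm2) ?orbT.
have w1 : zeta j nu < zeta j mu := zlt nu0 nm muN.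
have w2 := zmono (ltn0Sn nu) nm3 (leq_trans (leq_pred _) muN).
lra.
Qed.

End tiles.

(** * Tiles *)

Lemma dyadic_approx {R : realType} (y : R) : 1 <= y ->
  exists j : nat, y <= 2 ^+ j <= 2 * y.
Proof.
move=> y1; have ex : exists j, y <= 2 ^+ j :> R.
  exists (Num.truncn y).+1; apply: le_trans (_ : (Num.truncn y).+1%:R <= _).
    have /andP[_ /ltW//] : (Num.truncn y)%:R <= y < (Num.truncn y).+1%:R.
    by apply: truncn_itv; lra.
  by rewrite -natrX ler_nat ltnW// ltn_expl.
exists (ex_minn ex); case: ex_minnP => -[|j] hj hmin; rewrite hj/=.
  by rewrite expr0; lra.
rewrite exprS ler_pM2l// leNgt; apply/negP => /ltW /hmin.
by rewrite ltnn.
Qed.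

Section tiles.
Context {R : realType} (delta : R) (zeta : nat -> int -> R) (n : nat).
Hypothesis hzeta : forall j, hermite_zeros (level_size delta j) (zeta j).
Implicit Types (j : nat) (t : R).
Local Notation N := (level_size delta).
Local Notation cell j := (mesh (N j) (zeta j) (2 `^ (- (j%:R / 6)))).
Local Notation level := (level_index delta n).

Let ltP0 m (k : 'I_m) : (0 < k.+1 <= m)%N. Proof. by rewrite /= ltn_ord. Qed.

Lemma measurable_tile j (nu : level j) : measurable (tile zeta nu).
Proof.
rewrite /tile /tile_set.
apply: (@measurable_box R n (fun i =>
  [set t | cell j (nu i).2.+1 (if (nu i).1 then - t else t)])) => i.
pose a := (if (nu i).2.+1 == 1%N then 0 else
  (zeta j (nu i).2.+1.-1%:Z + zeta j (nu i).2.+1%:Z) / 2) : R.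
pose b := (if (nu i).2.+1 == N j then zeta j (N j)%:Z + 2 `^ (- (j%:R / 6)) else
  (zeta j (nu i).2.+1%:Z + zeta j (nu i).2.+2%:Z) / 2) : R.
rewrite (_ : mkset _ = if (nu i).1 then `[- b, - a]%classic else `[a, b]%classic).
  by case: ifP => _; exact: measurable_itv.
case: ifP => _; apply/seteqP; split => t; rewrite /mesh/= in_itv/= -/a -/b; lra.
Qed.

(** The added 1 absorbs the extension 2^(-j/6) of the outermost cell. *)
Lemma cell_bounded (hdelta : 0 < delta < 37^-1) j nu t : (0 < nu <= N j)%N ->
  cell j nu t -> `|t| <= 7 * 2 ^+ j + 1.
Proof.
move=> hnu; have N3 := level_size_ge3 delta j.
have pj : 1 <= 2 ^+ j :> R by rewrite exprn_ege1 ?ler1n.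
have zN m : (0 < m <= N j)%N -> 0 < zeta j m <= 7 * 2 ^+ j.
  by move=> hm; rewrite (zeta_gt0 hzeta hm) (zeta_le hzeta hdelta hm).
have e1 : 2 `^ (- (j%:R / 6)) <= 1 :> R.
  by rewrite -[leRHS](powRr0 2) ler_powR ?ler1n// oppr_le0 divr_ge0.
rewrite /mesh/= => /andP[h1 h2].
have t0 : 0 <= t.
  apply: le_trans h1; case: eqVneq => // nu1.
  have z1 : 0 < zeta j nu.-1 <= 7 * 2 ^+ j by apply/zN; clear -hnu nu1; lia.
  by have := zN _ hnu; lra.
rewrite ger0_norm//; apply: le_trans h2 _; case: eqVneq => nuN.
  have z1 : 0 < zeta j (N j) <= 7 * 2 ^+ j by apply/zN; clear -N3; lia.
  lra.
have z1 : 0 < zeta j nu.+1 <= 7 * 2 ^+ j by apply/zN; clear -hnu nuN; lia.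
by have := zN _ hnu; lra.
Qed.

(* A cell is determined by its sign, the parity of its index and one point. *)
Lemma tile_overlap j (x : Rn R n) :
  (#|[set nu : level j | `[<tile zeta nu x>]]%SET| <= 4 ^ n)%N.
Proof.
pose f (nu : level j) : {ffun 'I_n -> bool * bool} :=
  [ffun i => ((nu i).1, odd (nu i).2)].
rewrite -(@card_in_imset _ _ f); last first.
  move=> nu mu; rewrite !inE. move=> hnu hmu /ffunP E.
  apply/ffunP => i; have := E i; rewrite !ffunE => -[E1 E2].
  apply/eqP; rewrite -pair_eqE/= /pair_eq/= E1 eqxx/=; apply/eqP/val_inj/succn_inj.
  have := hnu i; have := hmu i; rewrite -E1.
  set t := (if _ then _ else _) => h1 h2.
  by apply: (cell_inj hzeta) h2 h1 _ => //=; rewrite E2.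
rewrite (leq_trans (max_card _))// card_ffun card_ord card_prod card_bool.
by [].
Qed.

Hypothesis hdelta : 0 < delta < 37^-1.

Lemma tile_contains_ball j (nu : level j) :
  exists2 x : Rn R n, sup_norm x <= 7 * 2 ^+ j &
    eball x (14 * 2 ^+ j)^-1 `<=` tile zeta nu.
Proof.
have /choice[c hc] : forall i, exists c : R, 0 <= c <= 7 * 2 ^+ j /\
    forall t, `|t - c| < (14 * 2 ^+ j)^-1 -> cell j (nu i).2.+1 t.
  move=> i; have [c h1 h2] := cell_contains_interval hdelta hzeta (ltP0 (nu i).2).
  by exists c.
exists [tuple (if (nu i).1 then - c i else c i) | i < n].
  apply: sup_norm_le => [|i]; first by rewrite mulr_ge0// exprn_ge0.
  rewrite tnth_mktuple; have [/andP[h1 h2] _] := hc i.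
  by case: ifP => _; rewrite ?normrN ger0_norm.
move=> y hy i; have := eball_coord i hy; rewrite tnth_mktuple.
have [_ h] := hc i; move=> hy'; apply: h; move: hy'.
by case: ifP => _; rewrite distrC// -normrN !opprD !opprK// addrC.
Qed.

Lemma tile_bounded j (nu : level j) :
  exists r : R, tile zeta nu `<=` eball [tuple 0 | i < n] r.
Proof.
exists (n%:R * (7 * 2 ^+ j + 1) + 1) => x hx.
have h0 : 0 <= 7 * 2 ^+ j + 1 :> R by rewrite addr_ge0 ?mulr_ge0 ?exprn_ge0.
apply: (@eball_box _ _ _ _ (7 * 2 ^+ j + 1)); last move=> i.
- by rewrite ltr_wpDl// mulr_ge0.
- by rewrite ltrDl.
- rewrite tnth_mktuple sub0r normrN.
  have := cell_bounded hdelta (ltP0 (nu i).2) (hx i).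
  by case: ifP; rewrite ?normrN.
Qed.

(** The restriction on r yields 1 + |x| <= 1 / r <= 2^j, so the intervals starting at the |x_i| lie
    in the range where [cell_in_interval] applies. *)
Lemma ball_contains_tile (x : Rn R n) r : 0 < r -> r <= (1 + sup_norm x)^-1 ->
  exists j (nu : level j),
    tile zeta nu `<=` eball x r /\ 2 ^+ j <= 40 * n.+1%:R / r.
Proof.
move=> r0; have s0 := sup_norm_ge0 x.
rewrite -[r in r <= _]invrK lef_pV2 ?posrE ?invr_gt0 ?ltr_wpDr// => hr.
have n1 : 1 <= n.+1%:R :> R by rewrite ler1n.
(* The factor 20 (n + 1) makes the interval length 16 / 2^j at most (4/5) r / (n + 1), so that n
   times it stays below r. *)
have [|j /andP[j1 j2]] := @dyadic_approx R (20 * n.+1%:R / r).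
  by rewrite -mulrA -[leLHS]mulr1 ler_pM//; nra.
have pj : 0 < 2 ^+ j :> R by rewrite exprn_gt0.
have rV : r * r^-1 = 1 by rewrite divff// gt_eqF.
have rj : r^-1 <= 2 ^+ j by move: j1; rewrite -mulrA; nra.
have r1 : r <= 1 by nra.
have small : 16 / 2 ^+ j <= 4 / 5 * r / n.+1%:R.
  rewrite ler_pdivrMr// mulrAC ler_pdivlMr//.
  have := j1; rewrite ler_pdivrMr//; lra.
have small1 : 16 / 2 ^+ j <= 4 / 5 * r.
  by apply: le_trans small _; rewrite ler_pdivrMr//; nra.
have /choice[k hk] : forall i, exists k : 'I_(N j),
    forall t, cell j k.+1 t -> `|tnth x i| <= t <= `|tnth x i| + 16 / 2 ^+ j.
  move=> i.
  have [|nu hnu h] :=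
    @cell_in_interval _ _ _ hdelta hzeta j `|tnth x i| (normr_ge0 _).
    by have := sup_norm_ge x i; lra.
  have hlt : (nu.-1 < N j)%N by case/andP: hnu => h1 h2; rewrite prednK.
  by exists (Ordinal hlt) => t; rewrite /= prednK; [exact: h|case/andP: hnu].
(* The tile takes the sign of each coordinate of x, so closeness to |x_i| becomes closeness to
   x_i. *)
exists j, [ffun i => (tnth x i < 0, k i)]; split; last by rewrite mulrAC; lra.
move=> y hy; apply: (@eball_box _ _ _ _ (16 / 2 ^+ j)) => // [|i].
  apply: (@le_lt_trans _ _ (n%:R * (4 / 5 * r / n.+1%:R))); first by rewrite ler_wpM2l.
  rewrite mulrA ltr_pdivrMr// -natr1; have : 0 <= n%:R :> R by []. 
  nra.
have := hy i; rewrite ffunE/= => /(hk i).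
by case: ltP => xi; [rewrite ltr0_norm// => h|rewrite ger0_norm// => h]; rewrite ler_norml; lra.
Qed.

End tiles.

(** * Masses of balls and tiles *)

Section mass.
Context {R : realType} {n : nat} (w : Rn R n -> R).
Hypothesis hw : weight w.
Implicit Types (A B : set (Rn R n)) (x : Rn R n) (r : R).
Local Open Scope ereal_scope.
Local Notation mu := (lebesgue_Rn n).

Lemma measurable_weight A : measurable_fun A (EFin \o w).
Proof.
by have [mw _ _] := hw; apply/measurable_EFinP; exact: measurable_funTS.
Qed.

Lemma wmass_ge0 A : 0 <= wmass w A.
Proof. by have [_ w0 _] := hw; apply: integral_ge0 => x _; rewrite lee_fin. Qed.

Lemma le_wmass A B : measurable A -> measurable B -> A `<=` B ->
  wmass w A <= wmass w B.
Proof.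
move=> mA mB AB; have [_ w0 _] := hw; apply: ge0_subset_integral => //.
- exact: measurable_weight.
- by move=> x _; rewrite lee_fin.
Qed.

Lemma cube_sub_eball x r : (0 < r)%R -> cube x (r / n.+1%:R) `<=` eball x r.
Proof.
move=> r0 y hy; have n0 : (0 < n.+1%:R :> R)%R by rewrite ltr0n.
have n1 : (0 <= n%:R :> R)%R by rewrite ler0n.
apply: (@eball_box _ _ _ _ (r / n.+1%:R / 2)) => // [|i]; last by rewrite distrC.
rewrite mulrA mulrA ltr_pdivrMr// ltr_pdivrMr// -natr1; nra.
Qed.

Lemma eball_sub_cube x r : eball x r `<=` cube x (2 * r).
Proof.
move=> y hy i; rewrite distrC (le_trans (ltW (eball_coord i hy)))//.
by lra.
Qed.

Lemma lebesgue_Rn_eball_fin_gt0 x r : (0 < r)%R -> 0 < mu (eball x r) < +oo.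
Proof.
move=> r0; have n0 : (0 < n.+1%:R :> R)%R by rewrite ltr0n.
apply/andP; split.
  have /andP[h _] := lebesgue_Rn_cube x (divr_gt0 r0 n0).
  apply: lt_le_trans h (le_measure _ _ _ (cube_sub_eball r0)); rewrite inE.
    exact: measurable_cube.
  exact: measurable_eball.
have /andP[_ h] : 0 < mu (cube x (2 * r)) < +oo by apply: lebesgue_Rn_cube; rewrite mulr_gt0.
apply: le_lt_trans (le_measure _ _ _ (@eball_sub_cube x r)) h; rewrite inE.
  exact: measurable_eball.
exact: measurable_cube.
Qed.

End mass.

Section tile_mass.
Context {R : realType} (delta : R) (zeta : nat -> int -> R) (n : nat).
Hypothesis hzeta : forall j, hermite_zeros (level_size delta j) (zeta j).
Hypothesis hdelta : 0 < delta < 37^-1.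
Variable w : Rn R n -> R.
Hypothesis hw : weight w.
Local Notation level := (level_index delta n).

Lemma tile_size_gt0 j (nu : level j) : 0 < tile_size zeta nu.
Proof.
have r0 : 0 < (14 * 2 ^+ j)^-1 :> R by rewrite invr_gt0 mulr_gt0 ?exprn_gt0.
have [x _ hx] := tile_contains_ball hzeta hdelta nu.
have [r hr] := tile_bounded hzeta hdelta nu.
have mt := measurable_tile zeta nu.
have r'0 : 0 < Num.max r 1 by rewrite lt_max ltr01 orbT.
have hr' : tile zeta nu `<=` eball [tuple 0 | _ < n] (Num.max r 1).
  by move=> y /hr; rewrite /eball/= lt_max => ->.
have /andP[h1 _] := lebesgue_Rn_eball_fin_gt0 x r0.
have /andP[_ h2] := lebesgue_Rn_eball_fin_gt0 [tuple 0 | _ < n] r'0.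
apply: fine_gt0; apply/andP; split.
  apply: (lt_le_trans h1); apply: le_measure => //; rewrite inE//.
  exact: measurable_eball.
apply: le_lt_trans h2; apply: le_measure => //; rewrite inE//.
exact: measurable_eball.
Qed.

Lemma wmass_tile_lty j (nu : level j) : (wmass w (tile zeta nu) < +oo)%E.
Proof.
have [r hr] := tile_bounded hzeta hdelta nu; have [_ _ h] := hw.
apply: le_lt_trans (h [tuple 0 | _ < n] r).
by apply: le_wmass => //; [exact: measurable_tile|exact: measurable_eball].
Qed.

Definition tile_lower_bound gamma := exists2 c : R, 0 < c &
  forall j (nu : level j),
    ((c * 2 `^ (- (j%:R * gamma)))%:E <= wmass w (tile zeta nu))%E.

Lemma wmass_tile_gt0 (hball : forall x r, 0 < r -> (0 < wmass w (eball x r))%E)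
  j (nu : level j) : (0 < wmass w (tile zeta nu))%E.
Proof.
have r0 : 0 < (14 * 2 ^+ j)^-1 :> R by rewrite invr_gt0 mulr_gt0 ?exprn_gt0.
have [x _ hx] := tile_contains_ball hzeta hdelta nu.
apply: lt_le_trans (hball x _ r0) _; apply: le_wmass => //.
  exact: measurable_eball.
exact: measurable_tile.
Qed.

Lemma pow2_powR (j : nat) (a : R) : (2 ^+ j) `^ a = 2 `^ (j%:R * a).
Proof. by rewrite -powR_mulrn// -powRrM. Qed.

(** The inscribed ball has a centre with |x| <= 7 2^j, hence 1 + |x| <= 14 2^j and its radius 1 /
    (14 2^j) is admissible. *)
Lemma lower_bound_tile gamma :
  lower_bound_property gamma w -> tile_lower_bound gamma.
Proof.
move=> [C C0 hC]; exists (C * 14 `^ (- gamma)); first by rewrite mulr_gt0 ?powR_gt0.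
move=> j nu; have pj : 1 <= 2 ^+ j :> R by rewrite exprn_ege1 ?ler1n.
have [x hx sub] := tile_contains_ball hzeta hdelta nu.
have r0 : 0 < (14 * 2 ^+ j)^-1 :> R by rewrite invr_gt0; lra.
apply: le_trans (le_wmass hw (measurable_eball _ _) (measurable_tile _ _) sub).
apply: le_trans (hC x _ r0 _); last first.
  by rewrite lef_pV2 ?posrE; have := sup_norm_ge0 x; lra.
rewrite lee_fin -mulrA ler_pM2l// -mulrN -pow2_powR -powRM ?exprn_ge0//.
by rewrite -powR_inv1 ?mulr_ge0 ?exprn_ge0// -powRrM mulN1r.
Qed.

Lemma tile_lower_bound_ball gamma : 0 < gamma ->
  tile_lower_bound gamma -> lower_bound_property gamma w.
Proof.
move=> g0 [c c0 hc]; set K : R := 40 * n.+1%:R.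
have K0 : 0 < K by rewrite mulr_gt0 ?ltr0n.
exists (c * K `^ (- gamma)); first by rewrite mulr_gt0 ?powR_gt0.
move=> x r r0 hr; have [j [nu [sub jr]]] := ball_contains_tile hzeta hdelta r0 hr.
apply: le_trans (le_wmass hw (measurable_tile _ _) (measurable_eball _ _) sub).
apply: le_trans (hc j nu); rewrite lee_fin -mulrA ler_pM2l// -mulrN -pow2_powR.
have -> : r `^ gamma = r^-1 `^ (- gamma).
  by rewrite -powR_inv1 ?ltW// -powRrM mulrNN mul1r.
rewrite -powRM ?invr_ge0 ?(ltW r0) ?(ltW K0)// !powRN.
have pj : 0 < 2 ^+ j :> R by rewrite exprn_gt0.
have Kr : 0 < K / r by rewrite divr_gt0.
by rewrite lef_pV2 ?posrE ?powR_gt0// ge0_ler_powR ?nnegrE// ltW.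
Qed.

End tile_mass.

(** * Sequence norms with extended values *)

Section ereal_lp.
Context {R : realType}.
Local Open Scope ereal_scope.

Lemma lee_poweR2r (x y : \bar R) (r : R) : (0 <= r)%R -> 0 <= x -> x <= y ->
  x `^ r <= y `^ r.
Proof.
move=> r0 x0 xy; apply: gt0_ler_poweR => //; rewrite in_itv/= leey andbT//.
exact: le_trans xy.
Qed.

Lemma poweRK (x : \bar R) (r : R) : r != 0%R -> 0 <= x -> (x `^ r) `^ r^-1 = x.
Proof. by move=> r0 x0; rewrite -poweRrM divff// poweRe1. Qed.

Lemma poweRVK (x : \bar R) (r : R) : r != 0%R -> 0 <= x -> (x `^ r^-1) `^ r = x.
Proof. by move=> r0 x0; rewrite -poweRrM mulVf// poweRe1. Qed.

(* Finite sums with maxima, and series with suprema, are the two instances. *)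
Record summation (I : Type) (S sp : (I -> \bar R) -> \bar R) : Prop := {
  summation_ge0 : forall f, (forall i, 0 <= f i) -> 0 <= S f ;
  summation_le : forall f g, (forall i, 0 <= f i) -> (forall i, f i <= g i) ->
    S f <= S g ;
  summation_ge : forall f i, (forall i, 0 <= f i) -> f i <= S f ;
  summationZ : forall (c : R) f, (0 <= c)%R -> (forall i, 0 <= f i) ->
    S (fun i => c%:E * f i) = c%:E * S f ;
  summation_single : forall f i, (forall i, 0 <= f i) ->
    (forall j, j <> i -> f j = 0) -> S f = f i ;
  supremum_ge0 : forall f, (forall i, 0 <= f i) -> 0 <= sp f ;
  supremum_ge : forall f i, f i <= sp f ;
  supremum_le : forall f b, 0 <= b -> (forall i, f i <= b) -> sp f <= b }.

Definition lp (I : Type) (S sp : (I -> \bar R) -> \bar R) (q : \bar R)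
    (a : I -> \bar R) : \bar R :=
  if q is r%:E then S (fun i => a i `^ r) `^ r^-1 else sp a.

Section lp_theory.
Variables (I : Type) (S sp : (I -> \bar R) -> \bar R).
Hypothesis hS : summation S sp.
Implicit Types (a b : I -> \bar R) (q : \bar R).

Lemma lp_ge0 q a : (forall i, 0 <= a i) -> 0 <= lp S sp q a.
Proof. by case: q => [r| |] a0 /=; [exact: poweR_ge0| |]; exact: (supremum_ge0 hS). Qed.

Lemma lp_le q a b : 0 < q -> (forall i, 0 <= a i) -> (forall i, a i <= b i) ->
  lp S sp q a <= lp S sp q b.
Proof.
move=> q0 a0 ab; have b0 i : 0 <= b i by exact: le_trans (ab i).
case: q q0 => [r| |//] q0 /=; last first.
  apply: (supremum_le hS) => [|i]; first exact: (supremum_ge0 hS).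
  exact: le_trans (ab i) (supremum_ge hS _ _).
rewrite lte_fin in q0; apply: lee_poweR2r; rewrite ?invr_ge0 ?(ltW q0)//.
  by apply: (summation_ge0 hS) => i; exact: poweR_ge0.
apply: (summation_le hS) => i; first exact: poweR_ge0.
exact: lee_poweR2r (ltW q0) (a0 i) (ab i).
Qed.

Lemma lp_ge q a i : 0 < q -> (forall i, 0 <= a i) -> a i <= lp S sp q a.
Proof.
move=> q0 a0; case: q q0 => [r| |//] q0 /=; last exact: (supremum_ge hS).
rewrite lte_fin in q0; have rN0 : r != 0%R by rewrite gt_eqF.
rewrite -[leLHS](poweRK rN0)//; apply: lee_poweR2r; rewrite ?invr_ge0 ?(ltW q0)//.
  exact: poweR_ge0.
by apply: (summation_ge hS (f := fun i => a i `^ r)) => k; exact: poweR_ge0.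
Qed.

Lemma lpZ q a (c : R) : 0 < q -> (0 < c)%R -> (forall i, 0 <= a i) ->
  lp S sp q (fun i => c%:E * a i) = c%:E * lp S sp q a.
Proof.
move=> q0 c0 a0; case: q q0 => [r| |//] q0 /=; last first.
  apply/eqP; rewrite eq_le; apply/andP; split.
    apply: (supremum_le hS) => [|i].
      by rewrite mule_ge0 ?lee_fin ?(ltW c0)//; exact: (supremum_ge0 hS).
    by rewrite lee_pmul2l//; exact: (supremum_ge hS).
  rewrite muleC -lee_pdivlMr//; apply: (supremum_le hS) => [|i].
    rewrite mule_ge0 ?lee_fin ?invr_ge0 ?(ltW c0)//.
    by apply: (supremum_ge0 hS) => i; rewrite mule_ge0 ?lee_fin ?(ltW c0).
  by rewrite lee_pdivlMr// muleC; exact: (supremum_ge hS (fun i => c%:E * a i)).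
rewrite lte_fin in q0; have rN0 : r != 0%R by rewrite gt_eqF.
under eq_fun do rewrite poweRM ?lee_fin ?(ltW c0)// poweR_EFin.
rewrite (summationZ hS) ?powR_ge0//; last by move=> i; exact: poweR_ge0.
rewrite poweRM ?lee_fin ?powR_ge0//.
  by rewrite poweR_EFin -powRrM divff// powRr1// ltW.
by apply: (summation_ge0 hS) => i; exact: poweR_ge0.
Qed.

Lemma lp_single q a i : 0 < q -> (forall i, 0 <= a i) ->
  (forall j, j <> i -> a j = 0) -> lp S sp q a = a i.
Proof.
move=> q0 a0 ai; case: q q0 => [r| |//] q0 /=; last first.
  apply/eqP; rewrite eq_le (supremum_ge hS) andbT; apply: (supremum_le hS) => // j.
  by have [->//|/ai ->] := pselect (j = i).
rewrite lte_fin in q0; have rN0 : r != 0%R by rewrite gt_eqF.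
rewrite (summation_single hS (i := i)) ?poweRK// => [j|j ji].
  exact: poweR_ge0.
by rewrite ai// poweR0r.
Qed.

Lemma lp_eq0 q a : 0 < q -> (forall i, a i = 0) -> lp S sp q a = 0.
Proof.
move=> q0 a0; have a_ge0 i : 0 <= a i by rewrite a0.
apply/eqP; rewrite eq_le lp_ge0// andbT.
case: q q0 => [r| |//] q0 /=; last by apply: (supremum_le hS) => // i; rewrite a0.
rewrite lte_fin in q0; have rN0 : r != 0%R by rewrite gt_eqF.
(* Homogeneity with the factor 0 evaluates the sum of the zero family, also over an empty index
   type. *)
have -> : (fun i => a i `^ r) = (fun i => 0%:E * a i).
  by apply/funext => i; rewrite a0 poweR0r// mule0.
by rewrite (summationZ hS)// mul0e poweR0r// invr_eq0.
Qed.

(* Each term is at most the norm m with the smaller exponent, and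
   [a i `^ r1 <= m `^ (r1 - r2) * a i `^ r2]. *)
Lemma lp_antimono q1 q2 a : 0 < q2 -> q2 <= q1 -> (forall i, 0 <= a i) ->
  lp S sp q1 a <= lp S sp q2 a.
Proof.
move=> q20 q21 a0.
have a_le i : a i <= lp S sp q2 a by exact: lp_ge.
have m0 : 0 <= lp S sp q2 a by exact: lp_ge0.
have [moo|mfin] := eqVneq (lp S sp q2 a) +oo; first by rewrite moo leey.
case: q1 q21 => [r1| |] q21; last by move: (lt_le_trans q20 q21).
  2: by apply: (supremum_le hS).
case: q2 q20 q21 a_le m0 mfin => [r2| |//] /= r20 r21 a_le m0 mfin; last first.
  by rewrite leye_eq in r21.
rewrite lte_fin in r20; rewrite lee_fin in r21.
have r10 : (0 < r1)%R := lt_le_trans r20 r21.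
have [r2N0 r1N0] : r2 != 0%R /\ r1 != 0%R by rewrite !gt_eqF.
have Sa0 : 0 <= S (fun i => a i `^ r2).
  by apply: (summation_ge0 hS) => i; exact: poweR_ge0.
have SE : S (fun i => a i `^ r2) = (S (fun i => a i `^ r2) `^ r2^-1) `^ r2.
  by rewrite poweRVK.
move: a_le m0 mfin SE; case: (S (fun i => a i `^ r2) `^ r2^-1) => [m| |//] a_le m0 mfin SE.
  2: by rewrite eqxx in mfin.
rewrite lee_fin in m0.
have [->|r12] := eqVneq r1 r2; first by rewrite SE poweRK.
rewrite -[leRHS](poweRK r1N0)//; apply: lee_poweR2r; rewrite ?invr_ge0 ?(ltW r10)//.
  by apply: (summation_ge0 hS) => i; exact: poweR_ge0.
have -> : m%:E `^ r1 = (m `^ (r1 - r2))%:E * S (fun i => a i `^ r2).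
  rewrite SE !poweR_EFin -EFinM -powRD; first by rewrite subrK.
  by rewrite subrK (negbTE r1N0).
rewrite -(summationZ hS) ?powR_ge0//; last by move=> i; exact: poweR_ge0.
apply: (summation_le hS) => i; first exact: poweR_ge0.
have := a_le i; have := a0 i; case: (a i) => [t| |//]; last by rewrite leye_eq.
rewrite !lee_fin => t0 tm.
have tE : (t `^ r1 = t `^ (r1 - r2) * t `^ r2)%R.
  by rewrite -powRD subrK// (negbTE r1N0).
change ((t `^ r1)%:E <= (m `^ (r1 - r2) * t `^ r2)%:E); rewrite lee_fin tE.
by rewrite ler_wpM2r ?powR_ge0// ge0_ler_powR ?nnegrE// subr_ge0.
Qed.

End lp_theory.

Lemma summation_fin (I : finType) :
  summation (fun f : I -> \bar R => \sum_i f i)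
    (fun f : I -> \bar R => \big[maxe/0]_i f i).
Proof.
split.
- by move=> f f0; exact: sume_ge0.
- by move=> f g f0 fg; exact: lee_sum.
- by move=> f i f0; rewrite (bigD1 i)//= leeDl// sume_ge0.
- by move=> c f c0 f0; rewrite ge0_sume_distrr.
- by move=> f i f0 fi; rewrite (bigD1 i)//= big1 ?adde0// => j /eqP /fi.
- by move=> f f0; exact: bigmax_ge_id.
- by move=> f i; exact: le_bigmax.
- by move=> f b b0 fb; exact: bigmax_le.
Qed.

Lemma summation_nat :
  summation (fun f : nat -> \bar R => \sum_(0 <= i <oo) f i)
    (fun f : nat -> \bar R => ereal_sup (range f)).
Proof.
have le_sup (f : nat -> \bar R) i : f i <= ereal_sup (range f).
  by apply: ereal_sup_ubound; exists i.
split.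
- by move=> f f0; exact: nneseries_ge0.
- by move=> f g f0 fg; exact: lee_nneseries.
- by move=> f i f0; rewrite (@nneseriesD1 _ _ i)// leeDl// nneseries_ge0.
- by move=> c f c0 f0; rewrite nneseriesZl.
- move=> f i f0 fi; rewrite (@nneseriesD1 _ _ i)// eseries0 ?adde0// => j _ /=.
  by move=> /eqP /fi.
- by move=> f f0; apply: le_trans (le_sup f 0%N).
- exact: le_sup.
- by move=> f b b0 fb; apply: ge_ereal_sup => _ [i _ <-].
Qed.

End ereal_lp.

(** * The norms of single-tile sequences *)

Section exponents.
Context {R : realType}.
Local Open Scope ereal_scope.

Definition inv_exponent (p : \bar R) : R := if p is r%:E then r^-1 else 0%R.

Definition mass_root (p m : \bar R) : \bar R :=
  if p is r%:E then m `^ r^-1 else 1.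

(** For p = oo both sides are 1, even at m = 0, since the power with exponent 0 is 1 there too. *)
Lemma mass_root_fin p (m : R) : mass_root p m%:E = (m `^ inv_exponent p)%:E.
Proof. by case: p => [r| |] //=; rewrite powRr0. Qed.

Lemma mass_root_ge0 p m : 0 <= mass_root p m.
Proof. by case: p => [r| |] //=; exact: poweR_ge0. Qed.

Lemma div_exponentE (g : R) p : div_exponent g p = (g * inv_exponent p)%R.
Proof. by case: p => [r| |] //=; rewrite mulr0. Qed.

Lemma inv_exponent_le p1 p2 : 0 < p1 -> 0 < p2 ->
  (inv_exponent p1 <= inv_exponent p2)%R -> p2 <= p1.
Proof.
case: p1 p2 => [r1| |//] [r2| |//] //=; rewrite ?lte_fin ?lee_fin ?leey//.
  by move=> r1p r2p; rewrite lef_pV2.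
by move=> r1p _; rewrite invr_le0 leNgt r1p.
Qed.

End exponents.

Local Notation fin_lp := (lp (fun f => \sum_i f i)%E (fun f => \big[maxe/0]_i f i)%E).
Local Notation nat_lp := (lp (fun f : nat -> \bar _ => \sum_(0 <= i <oo) f i)%E
  (fun f : nat -> \bar _ => ereal_sup (range f))).

Section norms.
Context {R : realType} (delta : R) (zeta : nat -> int -> R) (n : nat).
Variable w : Rn R n -> R.
Local Open Scope ereal_scope.
Local Notation level := (level_index delta n).
Implicit Types (s : tile_seq delta n) (p q : \bar R) (alpha : R) (j : nat).

Lemma coef_ge0 s j (nu : level j) : (0 <= coef zeta s nu)%R.
Proof.
rewrite /coef mulr_ge0 ?powR_ge0//; case: (s j nu) => a b.
exact: sqrtr_ge0.
Qed.

Lemma b_levelE p s j : 0 < p -> b_level zeta w p s j =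
  fin_lp p (fun nu : level j =>
    mass_root p (wmass w (tile zeta nu)) * (coef zeta s nu)%:E).
Proof.
case: p => [r| |//] p0 //=.
by rewrite /lp; apply: eq_bigr => nu _; rewrite mul1e.
Qed.

Let coefE_ge0 s j (nu : level j) : 0 <= (coef zeta s nu)%:E.
Proof. by rewrite lee_fin coef_ge0. Qed.

Let pow2 alpha j : 0 <= (2 `^ (j%:R * alpha))%:E :> \bar R.
Proof. by rewrite lee_fin powR_ge0. Qed.

Lemma b_level_ge0 p s j : 0 < p -> 0 <= b_level zeta w p s j.
Proof.
move=> p0; rewrite b_levelE//; apply: lp_ge0; first exact: summation_fin.
by move=> nu; rewrite mule_ge0// mass_root_ge0.
Qed.

(** Moving 2^(j alpha) inside the q-th power gives one formula for finite and infinite q. *)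
Lemma b_normE alpha p q s : 0 < p -> 0 < q ->
  b_norm delta zeta w alpha p q s =
  nat_lp q (fun j => (2 `^ (j%:R * alpha))%:E * b_level zeta w p s j).
Proof.
move=> p0; case: q => [r| |//] q0 //=; congr (_ `^ _).
apply: eq_eseriesr => j _; rewrite poweRM//; last exact: b_level_ge0.
by rewrite poweR_EFin -powRrM.
Qed.

(** The sum over the tiles of a level becomes a norm of its own: its q-th root cancels against the
    outer q-th power. *)
Lemma f_funE alpha q s x : 0 < q -> f_fun zeta alpha q s x =
  nat_lp q (fun j => (2 `^ (j%:R * alpha))%:E *
    fin_lp q (fun nu : level j => (\1_(tile zeta nu) x * coef zeta s nu)%:E)).
Proof.
case: q => [r| |//] q0 //=; congr (_ `^ _); rewrite lte_fin in q0.
apply: eq_eseriesr => j _; rewrite [RHS]poweRM//; last exact: poweR_ge0.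
rewrite poweRVK ?gt_eqF//; first by rewrite poweR_EFin -powRrM.
by apply: sume_ge0 => nu _; rewrite lee_fin powR_ge0.
Qed.

Lemma f_fun_ge0 alpha q s x : 0 < q -> 0 <= f_fun zeta alpha q s x.
Proof.
move=> q0; rewrite f_funE//; apply: lp_ge0; first exact: summation_nat.
move=> j; rewrite mule_ge0//; apply: lp_ge0; first exact: summation_fin.
by move=> nu; rewrite lee_fin mulr_ge0// coef_ge0.
Qed.

(** Indices of different levels have different types, so they are compared as tagged pairs. *)
Definition single_seq j0 (nu0 : level j0) : tile_seq delta n :=
  fun j nu => if Tagged (fun j => level j) nu == Tagged (fun j => level j) nu0
              then complex.Complex 1%R 0%R else complex.Complex 0%R 0%R.

Lemma coef_single_diag j (nu : level j) :
  coef zeta (single_seq nu) nu = (tile_size zeta nu `^ (- 2^-1))%R.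
Proof.
rewrite /coef /single_seq eqxx /complex.ComplexField.Normc.normc/=.
by rewrite expr1n expr0n/= addr0 sqrtr1 mulr1.
Qed.

Lemma coef_single_off j0 (nu0 : level j0) j (nu : level j) :
  Tagged (fun j => level j) nu <> Tagged (fun j => level j) nu0 ->
  coef zeta (single_seq nu0) nu = 0%R.
Proof.
move=> /eqP/negbTE h; rewrite /coef /single_seq h /complex.ComplexField.Normc.normc/=.
by rewrite expr0n/= addr0 sqrtr0 mulr0.
Qed.

Lemma coef_single_level j0 (nu0 : level j0) j (nu : level j) : j <> j0 ->
  coef zeta (single_seq nu0) nu = 0%R.
Proof. by move=> h; apply: coef_single_off => E; apply: h; exact: (f_equal tag E). Qed.

Lemma coef_single_index j (nu0 nu : level j) : nu <> nu0 ->
  coef zeta (single_seq nu0) nu = 0%R.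
Proof.
by move=> h; apply: coef_single_off => /eqP; rewrite eq_Tagged/= => /eqP.
Qed.

Lemma b_norm_single alpha p q j (nu : level j) : 0 < p -> 0 < q ->
  b_norm delta zeta w alpha p q (single_seq nu) = (2 `^ (j%:R * alpha))%:E *
    (mass_root p (wmass w (tile zeta nu)) * (tile_size zeta nu `^ (- 2^-1))%:E).
Proof.
move=> p0 q0; rewrite b_normE// (lp_single summation_nat (i := j))//.
- rewrite b_levelE// (lp_single (summation_fin _) (i := nu))//.
  + by rewrite coef_single_diag.
  + by move=> mu; rewrite mule_ge0// mass_root_ge0.
  + by move=> mu h; rewrite coef_single_index// mule0.
- by move=> k; rewrite mule_ge0// b_level_ge0.
- move=> k kj; rewrite b_levelE//.
  rewrite (lp_eq0 (summation_fin _)) ?mule0// => mu.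
  by rewrite coef_single_level// mule0.
Qed.

End norms.

(** * Embeddings of the b-spaces *)

(** In m^e2 = m^d m^e1 with d = e2 - e1 >= 0, the lower bound on m bounds m^d from below. It serves
    with m = w(R) and e_i = 1 / p_i. *)
Lemma powR_lower_compare {R : realType} (c m gamma e1 e2 : R) (j : nat) :
  0 < c -> c * 2 `^ (- (j%:R * gamma)) <= m -> e1 <= e2 ->
  m `^ e1 <= c `^ (- (e2 - e1)) * 2 `^ (j%:R * (gamma * (e2 - e1))) * m `^ e2.
Proof.
move=> c0 cm e12; set d := e2 - e1; have d0 : 0 <= d by rewrite subr_ge0.
have cj0 : 0 < c * 2 `^ (- (j%:R * gamma)) by rewrite mulr_gt0 ?powR_gt0.
have m0 : 0 < m := lt_le_trans cj0 cm.
have -> : m `^ e2 = m `^ d * m `^ e1.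
  by rewrite -powRD ?(gt_eqF m0) ?implybT// /d subrK.
rewrite mulrA ler_peMl ?powR_ge0//.
have h : c `^ d * (2 `^ (j%:R * (gamma * d)))^-1 <= m `^ d.
  rewrite -powRN mulrA -mulNr powRrM -powRM ?powR_ge0 ?(ltW c0)//.
  by rewrite ge0_ler_powR ?nnegrE// ltW.
rewrite powRN.
have X0 : 0 < (c `^ d)^-1 * 2 `^ (j%:R * (gamma * d)).
  by rewrite mulr_gt0 ?invr_gt0 ?powR_gt0.
by rewrite -(ler_pdivrMl _ _ X0) mulr1 invfM invrK.
Qed.

(** Dividing by m^e1 > 0 leaves a lower bound on m^d with d = e2 - e1, and d > 0 allows the d-th
    root. *)
Lemma powR_lower_of_test {R : realType} (C m gamma e1 e2 : R) (j : nat) :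
  0 < C -> 0 < m -> e1 < e2 ->
  m `^ e1 <= C * 2 `^ (j%:R * (gamma * (e2 - e1))) * m `^ e2 ->
  C `^ (- (e2 - e1)^-1) * 2 `^ (- (j%:R * gamma)) <= m.
Proof.
move=> C0 m0 e12; set d := e2 - e1; have d0 : 0 < d by rewrite subr_gt0.
have -> : m `^ e2 = m `^ d * m `^ e1.
  by rewrite -powRD ?(gt_eqF m0) ?implybT// /d subrK.
rewrite mulrA -[leLHS]mul1r ler_pM2r ?powR_gt0// => h.
have {}h : (C * 2 `^ (j%:R * (gamma * d)))^-1 <= m `^ d.
  by rewrite -[leLHS]mulr1 ler_pdivrMl// mulr_gt0// powR_gt0.
have mE : m = (m `^ d) `^ d^-1 by rewrite -powRrM divff ?gt_eqF// powRr1 ?ltW.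
rewrite [leRHS]mE.
have : ((C * 2 `^ (j%:R * (gamma * d)))^-1) `^ d^-1 <= (m `^ d) `^ d^-1.
  rewrite ge0_ler_powR ?nnegrE ?invr_ge0 ?powR_ge0 ?(ltW d0)//.
  by rewrite mulr_ge0 ?powR_ge0// ltW.
apply: le_trans; rewrite -[X in _ <= X `^ _]powR_inv1 ?mulr_ge0 ?powR_ge0 ?(ltW C0)//.
rewrite -powRrM powRM ?powR_ge0 ?(ltW C0)// mulN1r -powRrM.
by rewrite mulrN mulrA mulfK ?gt_eqF.
Qed.

Section b_embedding.
Context {R : realType} (delta : R) (zeta : nat -> int -> R) (n : nat).
Hypothesis hzeta : forall j, hermite_zeros (level_size delta j) (zeta j).
Hypothesis hdelta : 0 < delta < 37^-1.
Variable w : Rn R n -> R.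
Hypothesis hw : weight w.
Local Notation level := (level_index delta n).

Lemma wmass_tileE j (nu : level j) :
  wmass w (tile zeta nu) = (fine (wmass w (tile zeta nu)))%:E.
Proof.
by rewrite fineK// ge0_fin_numE ?wmass_ge0//; exact: wmass_tile_lty.
Qed.

(** The exponent identity reads gamma (1/p2 - 1/p1) = alpha2 - alpha1 >= 0, whence p2 <= p1. The
    target norm grows when q1 is replaced by q2 and then p1 by p2 inside each level; what remains is
    a termwise comparison of masses. *)
Lemma b_embeds_of_tile_lower_bound (gamma alpha1 alpha2 : R) (p1 p2 q1 q2 : \bar R) :
  0 < gamma -> alpha1 <= alpha2 ->
  (0 < p1)%E -> (0 < p2)%E -> (0 < q2)%E -> (q2 <= q1)%E ->
  alpha1 - div_exponent gamma p1 = alpha2 - div_exponent gamma p2 ->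
  tile_lower_bound delta zeta w gamma ->
  embeds (b_norm delta zeta w alpha2 p2 q2) (b_norm delta zeta w alpha1 p1 q1).
Proof.
move=> g0 a12 p10 p20 q20 q21; rewrite !div_exponentE => aE [c c0 hc].
set e1 := inv_exponent p1 in aE *; set e2 := inv_exponent p2 in aE *.
have e12 : e1 <= e2.
  by rewrite -(ler_pM2l g0); lra.
have p21 : (p2 <= p1)%E by exact: inv_exponent_le.
have q10 : (0 < q1)%E := lt_le_trans q20 q21.
pose K := c `^ (- (e2 - e1)); have K0 : 0 < K by rewrite powR_gt0.
exists K => // s _; rewrite !b_normE//.
have coef0 j (nu : level j) : (0 <= (coef zeta s nu)%:E)%E.
  by rewrite lee_fin coef_ge0.
have term0 p j (nu : level j) :
    (0 <= mass_root p (wmass w (tile zeta nu)) * (coef zeta s nu)%:E)%E.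
  by rewrite mule_ge0// mass_root_ge0.
have level0 p alpha j : (0 < p)%E ->
    (0 <= (2 `^ (j%:R * alpha))%:E * b_level zeta w p s j)%E.
  by move=> p0; rewrite mule_ge0 ?lee_fin ?powR_ge0// b_level_ge0.
rewrite -(lpZ summation_nat)//; last by move=> j; exact: level0.
apply: (@le_trans _ _ (nat_lp q2 (fun j =>
    ((2 `^ (j%:R * alpha1))%:E * b_level zeta w p1 s j)%E))).
  by apply: (lp_antimono summation_nat) => // j; exact: level0.
apply: (lp_le summation_nat) => // j; first exact: level0.
rewrite !b_levelE//.
apply: (@le_trans _ _ ((2 `^ (j%:R * alpha1))%:E * fin_lp p2 (fun nu : level j =>
    mass_root p1 (wmass w (tile zeta nu)) * (coef zeta s nu)%:E))%E).
  by rewrite lee_wpmul2l ?lee_fin ?powR_ge0//; exact: (lp_antimono (summation_fin _)).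
rewrite muleA -EFinM.
have -> : (K * 2 `^ (j%:R * alpha2) = 2 `^ (j%:R * alpha1) *
    (K * 2 `^ (j%:R * (gamma * (e2 - e1)))))%R.
  have -> : gamma * (e2 - e1) = alpha2 - alpha1 by lra.
  rewrite mulrCA -powRD; first by rewrite -mulrDr addrC subrK.
  by rewrite pnatr_eq0 implybT.
rewrite EFinM -muleA lee_wpmul2l ?lee_fin ?powR_ge0//.
rewrite -(lpZ (summation_fin _))//; last by rewrite mulr_gt0// powR_gt0.
apply: (lp_le (summation_fin _)) => // nu; rewrite muleA lee_wpmul2r//.
have := hc j nu; rewrite wmass_tileE !mass_root_fin -EFinM !lee_fin => h.
exact: powR_lower_compare.
Qed.

(** Single-tile sequences have the same b-norm and f-norm for finite p, so one test inequality
    serves both kinds of spaces. *)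
Lemma tile_lower_bound_of_test (gamma alpha1 alpha2 : R) (p1 p2 : \bar R) (C : R) :
  0 < gamma -> 0 < C -> alpha1 < alpha2 -> (0 < p1)%E -> (0 < p2)%E ->
  alpha1 - div_exponent gamma p1 = alpha2 - div_exponent gamma p2 ->
  (p1 = +oo \/ forall j (nu : level j), 0 < wmass w (tile zeta nu))%E ->
  (forall j (nu : level j),
    ((2 `^ (j%:R * alpha1))%:E * mass_root p1 (wmass w (tile zeta nu)) <=
     C%:E * ((2 `^ (j%:R * alpha2))%:E * mass_root p2 (wmass w (tile zeta nu))))%E) ->
  tile_lower_bound delta zeta w gamma.
Proof.
move=> g0 C0 a12 p10 p20; rewrite !div_exponentE.
set e1 := inv_exponent p1; set e2 := inv_exponent p2 => aE hpos htest.
have e12 : e1 < e2 by rewrite -(ltr_pM2l g0); lra.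
exists (C `^ (- (e2 - e1)^-1)); first by rewrite powR_gt0.
move=> j nu; have := htest j nu; rewrite wmass_tileE !mass_root_fin -/e1 -/e2.
rewrite -!EFinM !lee_fin => h.
have m0 : 0 < fine (wmass w (tile zeta nu)).
  case: hpos => [p1oo|/(_ j nu)]; last by rewrite {1}wmass_tileE lte_fin.
  (* For p1 = oo the left side of the test is 2^(j alpha1) > 0, while a tile of mass 0 would make
     the right side 0, since 1 / p2 > 0. *)
  rewrite lt_neqAle fine_ge0 ?wmass_ge0// andbT; apply/eqP => m0.
  move: h; rewrite -m0 /e1 p1oo/= powRr0 powR0; last first.
    by move: e12; rewrite /e1 p1oo/= => /gt_eqF ->.
  by rewrite !mulr0 mulr1 leNgt powR_gt0.
apply: powR_lower_of_test => //.
have -> : gamma * (e2 - e1) = alpha2 - alpha1 by lra.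
rewrite -(ler_pM2l (powR_gt0 (j%:R * alpha1) (ltr0n _ 2))) (le_trans h)//.
rewrite [leRHS]mulrA (mulrCA _ C) -powRD ?pnatr_eq0 ?implybT// -mulrDr.
by rewrite (addrC alpha1) subrK mulrA.
Qed.

Lemma tile_lower_bound_of_b_embeds (gamma alpha1 alpha2 : R) (p1 p2 q1 q2 : \bar R) :
  0 < gamma -> alpha1 < alpha2 ->
  (0 < p1)%E -> (0 < p2)%E -> (0 < q1)%E -> (0 < q2)%E ->
  alpha1 - div_exponent gamma p1 = alpha2 - div_exponent gamma p2 ->
  (p1 = +oo \/ forall j (nu : level j), 0 < wmass w (tile zeta nu))%E ->
  embeds (b_norm delta zeta w alpha2 p2 q2) (b_norm delta zeta w alpha1 p1 q1) ->
  tile_lower_bound delta zeta w gamma.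
Proof.
move=> g0 a12 p10 p20 q10 q20 aE hpos [C C0 hC].
apply: (tile_lower_bound_of_test g0 C0 a12 p10 p20 aE hpos) => j nu.
have := hC (single_seq nu); rewrite !b_norm_single//.
(* The factor |R|^(-1/2) is common to both norms and cancels. *)
set k := (_ `^ (- 2^-1)); have k0 : 0 < k by rewrite powR_gt0// tile_size_gt0.
rewrite !muleA => h; rewrite -(@lee_pmul2r _ k%:E)//; apply: h.
by rewrite wmass_tileE mass_root_fin -!EFinM ltry.
Qed.

End b_embedding.

(** * The f-norms and the weight class *)

Section measurable_lp.
Context d (T : measurableType d) (R : realType).
Local Open Scope ereal_scope.

Lemma measurable_fin_lp (I : finType) (q : \bar R) (f : I -> T -> \bar R) :
  0 < q -> (forall i, measurable_fun setT (f i)) ->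
  measurable_fun setT (fun x => fin_lp q (fun i => f i x)).
Proof.
move=> q0 mf; case: q q0 => [r| |//] _ /=.
  apply: (measurableT_comp (measurable_poweR _)).
  apply: emeasurable_sum => i.
  exact: (measurableT_comp (measurable_poweR _)).
elim: (index_enum I) => [|i l ih].
  by under eq_fun do rewrite big_nil; exact: measurable_cst.
by under eq_fun do rewrite big_cons; exact: measurable_maxe.
Qed.

Lemma measurable_nat_lp (q : \bar R) (f : nat -> T -> \bar R) :
  0 < q -> (forall i x, 0 <= f i x) -> (forall i, measurable_fun setT (f i)) ->
  measurable_fun setT (fun x => nat_lp q (fun i => f i x)).
Proof.
move=> q0 f0 mf; case: q q0 => [r| |//] _ /=.
  apply: (measurableT_comp (measurable_poweR _)).
  apply: (ge0_emeasurable_sum (P := xpredT) (h := fun i x => f i x `^ r)) => [k x _ _|k _].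
    exact: poweR_ge0.
  exact: (measurableT_comp (measurable_poweR _)).
have := measurable_fun_esups mf 0%N; congr (measurable_fun _ _).
apply/funext => x; rewrite /esups/=; congr ereal_sup.
by apply/seteqP; split => _ [i _ <-]; exists i.
Qed.

End measurable_lp.

Section f_norms.
Context {R : realType} (delta : R) (zeta : nat -> int -> R) (n : nat).
Hypothesis hzeta : forall j, hermite_zeros (level_size delta j) (zeta j).
Hypothesis hdelta : 0 < delta < 37^-1.
Variable w : Rn R n -> R.
Hypothesis hw : weight w.
Local Open Scope ereal_scope.
Local Notation level := (level_index delta n).
Local Notation mu := (lebesgue_Rn n).
Implicit Types (s : tile_seq delta n) (q : \bar R) (alpha p : R).

Lemma measurable_f_fun alpha q s : 0 < q ->
  measurable_fun setT (f_fun zeta alpha q s).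
Proof.
move=> q0; rewrite (_ : f_fun zeta alpha q s = fun x => nat_lp q (fun j =>
    (2 `^ (j%:R * alpha))%:E *
    fin_lp q (fun nu : level j => (\1_(tile zeta nu) x * coef zeta s nu)%:E))); last first.
  by apply/funext => x; rewrite f_funE.
apply: measurable_nat_lp => // j.
  move=> x; rewrite mule_ge0 ?lee_fin ?powR_ge0//.
  by apply: (lp_ge0 (summation_fin _)) => nu; rewrite lee_fin mulr_ge0// coef_ge0.
apply: measurable_funeM; apply: measurable_fin_lp => // nu.
apply/measurable_EFinP; apply: measurable_funM => //.
by apply: measurable_indic; exact: measurable_tile.
Qed.

Lemma integral_weight_indic (A : set (Rn R n)) p (c : R) : measurable A ->
  (0 < p)%R -> (0 <= c)%R ->
  \int[mu]_x ((c * \1_A x)%:E `^ p * (w x)%:E) = (c `^ p)%:E * wmass w A.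
Proof.
move=> mA p0 c0; have [_ w0 _] := hw.
have <- : \int[mu]_(x in A) ((c `^ p)%:E * (w x)%:E) = (c `^ p)%:E * wmass w A.
  apply: ge0_integralZl => [//||x _|]; rewrite ?lee_fin ?powR_ge0//.
  exact: measurable_weight.
rewrite [RHS]integral_mkcond; apply: eq_integral => x _.
rewrite /patch indicE; case: ifPn => xA; first by rewrite mulr1.
by rewrite mulr0 poweR0r ?mul0e// gt_eqF.
Qed.

Lemma measurable_f_integrand p (f : Rn R n -> \bar R) :
  measurable_fun setT f ->
  measurable_fun setT (fun x => f x `^ p * (w x)%:E).
Proof.
move=> mf; apply: emeasurable_funM; last exact: measurable_weight.
exact: (measurableT_comp (measurable_poweR _)).
Qed.

Lemma f_fun_single alpha q j (nu : level j) x : 0 < q ->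
  f_fun zeta alpha q (single_seq nu) x =
  ((2 `^ (j%:R * alpha) * tile_size zeta nu `^ (- 2^-1)) * \1_(tile zeta nu) x)%:E.
Proof.
move=> q0; rewrite f_funE// (lp_single summation_nat (i := j))//.
- rewrite (lp_single (summation_fin _) (i := nu))//.
  + by rewrite coef_single_diag -EFinM mulrA mulrAC.
  + by move=> k; rewrite lee_fin mulr_ge0// coef_ge0.
  + by move=> k h; rewrite coef_single_index// mulr0.
- move=> k; rewrite mule_ge0 ?lee_fin ?powR_ge0//.
  by apply: (lp_ge0 (summation_fin _)) => mu'; rewrite lee_fin mulr_ge0// coef_ge0.
- move=> k kj; rewrite (lp_eq0 (summation_fin _)) ?mule0// => mu'.
  by rewrite coef_single_level// mulr0.
Qed.

Lemma f_norm_single alpha p q j (nu : level j) : (0 < p)%R -> 0 < q ->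
  f_norm delta zeta w alpha p q (single_seq nu) = (2 `^ (j%:R * alpha))%:E *
    (mass_root p%:E (wmass w (tile zeta nu)) * (tile_size zeta nu `^ (- 2^-1))%:E).
Proof.
move=> p0 q0; rewrite /f_norm.
under eq_integral do rewrite f_fun_single//.
rewrite integral_weight_indic ?mulr_ge0 ?powR_ge0//; last exact: measurable_tile.
rewrite poweRM ?wmass_ge0 ?lee_fin ?powR_ge0// poweR_EFin -powRrM divff ?gt_eqF//.
by rewrite powRr1 ?mulr_ge0 ?powR_ge0// EFinM -muleA [X in _ * X]muleC.
Qed.

Lemma tile_lower_bound_of_f_embeds (gamma alpha1 alpha2 p1 p2 : R) (q1 q2 : \bar R) :
  (0 < gamma)%R -> (alpha1 < alpha2)%R ->
  (0 < p1)%R -> (0 < p2)%R -> 0 < q1 -> 0 < q2 ->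
  (alpha1 - gamma / p1 = alpha2 - gamma / p2)%R ->
  (forall j (nu : level j), 0 < wmass w (tile zeta nu)) ->
  embeds (f_norm delta zeta w alpha2 p2 q2) (f_norm delta zeta w alpha1 p1 q1) ->
  tile_lower_bound delta zeta w gamma.
Proof.
move=> g0 a12 p10 p20 q10 q20 aE hpos [C C0 hC].
apply: (tile_lower_bound_of_test hzeta hdelta hw g0 C0 a12 (p1 := p1%:E) (p2 := p2%:E)) => //.
  by right.
move=> j nu; have := hC (single_seq nu); rewrite !f_norm_single//.
set k := (_ `^ (- 2^-1))%R; have k0 : (0 < k)%R by rewrite powR_gt0// (tile_size_gt0 hzeta).
rewrite !muleA => h; rewrite -(@lee_pmul2r _ k%:E)//; apply: h.
by rewrite (wmass_tileE hzeta hdelta hw) mass_root_fin -!EFinM ltry.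
Qed.

(** * Positive mass of balls for weights in the class *)

Lemma ae_weight_eq0 (A : set (Rn R n)) : measurable A ->
  wmass w A = 0 <-> mu.-negligible (A `\` [set x | w x = 0%R]).
Proof.
move=> mA; have [mw w0 _] := hw.
have E : wmass w A = \int[mu]_(x in A) `|(EFin \o w) x|.
  by apply: eq_integral => x _ /=; rewrite ger0_norm.
rewrite E (ae_eq_integral_abs mu mA (@measurable_weight _ _ _ hw A)).
rewrite /ae_eq; apply: (iff_trans
  (B := mu.-negligible (~` [set x | A x -> (EFin \o w) x = 0]))) => //.
rewrite (_ : ~` _ = A `\` [set x | w x = 0%R])//.
apply/seteqP; split => x /=.
  move=> /not_implyP[Ax h]; split => // wx; apply: h; by rewrite /= wx.
by move=> [Ax h] /(_ Ax) [].
Qed.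

(** If a ball has mass 0, then w vanishes on a subset E of positive measure. The weight condition on
    a cube containing E then forces mass 0 of the cube: for p = 1 the average is bounded by w = 0 on
    almost all of E, and for p > 1 the dual average is infinite. *)
Lemma ball_mass_gt0 : Ainfty w -> 0 < wmass w setT ->
  forall x r, (0 < r)%R -> 0 < wmass w (eball x r).
Proof.
move=> [p [eta [p1 eta0 [_ hA]]]] wT x r r0.
rewrite lt_neqAle wmass_ge0// andbT eq_sym; apply/eqP => wB.
have [mw w0 _] := hw.
set Z := [set x | w x = 0%R].
have mZ : measurable Z.
  rewrite (_ : Z = setT `&` w @^-1` [set 0%R]); first exact: mw.
  by rewrite setTI.
set E := eball x r `&` Z; have mB := measurable_eball x r.
have mE : measurable E by exact: measurableI.
have muE : 0 < mu E.
  have /andP[h _] := lebesgue_Rn_eball_fin_gt0 x r0.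
  move/(ae_weight_eq0 mB) : wB => /negligibleP wB.
  move: h; rewrite (measureDI mu mB mZ) wB ?add0e//.
  exact: measurableD.
(* Cubes around x of side at least 2 r contain the ball, and countably many of them exhaust the
   space. *)
suff hQ l : (2 * r <= l)%R -> wmass w (cube x l) = 0.
  move: wT; suff -> : wmass w setT = 0 by rewrite ltxx.
  apply/ae_weight_eq0 => //.
  have -> : setT `\` Z = \bigcup_k (cube x (2 * r + k%:R)%R `\` Z).
    apply/seteqP; split => [y [_ yZ]|y [k _ [_ yZ]]]; last by [].
    pose z : Rn R n := [tuple tnth y i - tnth x i | i < n]%R.
    have [k hk] : exists k : nat, (2 * sup_norm z <= k%:R)%R.
      exists (Num.truncn (2 * sup_norm z)).+1.
      have /andP[_ /ltW//] := truncn_itv (mulr_ge0 (ler0n _ 2) (sup_norm_ge0 z)).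
    exists k => //; split => // i.
    by have := sup_norm_ge z i; rewrite tnth_mktuple; lra.
  apply: negligible_bigcup => k; apply/ae_weight_eq0; first exact: measurable_cube.
  by apply: hQ; rewrite lerDl.
move=> rl; have l0 : (0 < l)%R by apply: lt_le_trans rl; rewrite mulr_gt0.
have mQ := measurable_cube x l.
have EQ : E `<=` cube x l.
  move=> y [/eball_sub_cube hy _] i; apply: le_trans (hy i) _.
  by rewrite ler_pM2r.
have /andP[muQ0 muQoo] := lebesgue_Rn_cube x l0.
have muQ : (0 < (fine (mu (cube x l)))^-1)%R by rewrite invr_gt0 fine_gt0// muQ0.
move: hA; case: eqVneq => [_|pN1] hA.
  apply: contrapT => wQ; have wQ0 : 0 < wmass w (cube x l).
    by rewrite lt_neqAle wmass_ge0// andbT eq_sym; apply/eqP.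
  have [N [mN muN subN]] := hA x l l0.
  (* If the cube had positive mass, the pointwise bound would fail at every point of E, so E would
     lie in the exceptional null set. *)
  have EN : E `<=` N.
    move=> y Ey; apply: subN => /(_ (EQ _ Ey)); have [_ -> ] := Ey.
    apply/negP; rewrite -ltNge mule_gt0// ?lte_fin ?invr_gt0 ?powR_gt0//.
      by rewrite ltr_wpDr// divr_ge0 ?(ltW l0)// /rho invr_ge0 addr_ge0 ?sup_norm_ge0.
    by rewrite /average mule_gt0.
  have negE : mu.-negligible E by exists N.
  by move: muE; rewrite (measure_negligible mE negE) ltxx.
have p1' : (1 < p)%R by rewrite lt_neqAle eq_sym pN1.
have [C C0 /(_ x l l0)] := hA.
set np := average _ (neg_power _ _).
have mnp : measurable_fun setT (neg_power w (p - 1)^-1).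
  apply: measurable_fun_ifT => //.
    apply: (measurable_fun_bool true); rewrite setTI.
    by rewrite (_ : _ @^-1` _ = Z)//; apply/seteqP; split => y /= /eqP.
  apply/measurable_EFinP; exact: (measurableT_comp (measurable_powR _) mw).
have np0 y : 0 <= neg_power w (p - 1)^-1 y.
  by rewrite /neg_power; case: ifP => // _; rewrite lee_fin powR_ge0.
(* The negative power of w is infinite on E, a set of positive measure inside the cube. *)
have npoo : np = +oo.
  rewrite /np /average.
  have -> : \int[mu]_(y in cube x l) neg_power w (p - 1)^-1 y = +oo.
    apply/eqP; rewrite -leye_eq.
    apply: (@le_trans _ _ (\int[mu]_(y in E) neg_power w (p - 1)^-1 y)); last first.
      apply: ge0_subset_integral => //; exact: measurable_funTS.
    rewrite (eq_integral (cst +oo)); last first.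
      by move=> y /set_mem[_ wy]; rewrite /neg_power wy eqxx.
    by rewrite integral_cst// gt0_mulye.
  by rewrite gt0_muley.
rewrite npoo poweRyr; last first.
  by rewrite subr_eq0 eq_sym invr_eq1.
move=> h; apply: contrapT => wQ; have wQ0 : 0 < wmass w (cube x l).
  by rewrite lt_neqAle wmass_ge0// andbT eq_sym; apply/eqP.
move: h; rewrite gt0_muley; first by rewrite leye_eq.
by apply: poweR_gt0; rewrite /average mule_gt0.
Qed.

End f_norms.

(** * Sums of minima of two geometric sequences *)

Section interpolation.
Context {R : realType}.
Implicit Types (rho lambda d e A B X : R) (q : \bar R).

Lemma powR_le1 rho (x : R) : 0 < rho < 1 -> 0 <= x -> rho `^ x <= 1.
Proof.
move=> /andP[r0 r1] x0.
apply: (@le_trans _ _ (1 `^ x)); last by rewrite powR1.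
by rewrite ge0_ler_powR ?nnegrE// ltW.
Qed.

(* The sum telescopes below the increments of the bounded function F, which
   is [rho `^ (lambda - t)] left of lambda and [2 - rho `^ (t - lambda)]
   right of it. *)
Lemma two_sided_geometric rho lambda (N : nat) : 0 < rho < 1 ->
  \sum_(0 <= j < N) rho `^ `|j%:R - lambda| <= 2 / (1 - rho).
Proof.
move=> hr; have /andP[r0 r1] := hr.
pose F (t : R) := if t <= lambda then rho `^ (lambda - t) else 2 - rho `^ (t - lambda).
have F02 t : 0 <= F t <= 2.
  rewrite /F; case: ifP => [tl|/negbT]; last rewrite -ltNge => lt.
    have h : rho `^ (lambda - t) <= 1 by rewrite powR_le1// subr_ge0.
    by rewrite powR_ge0/=; lra.
  have h : rho `^ (t - lambda) <= 1 by rewrite powR_le1// subr_ge0 ltW.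
  have := powR_ge0 rho (t - lambda); lra.
have rS (x : R) : rho `^ (x + 1) = rho `^ x * rho.
  by rewrite powRD ?(gt_eqF r0) ?implybT// powRr1// ltW.
have step t : rho `^ `|t - lambda| * (1 - rho) <= F (t + 1) - F t.
  rewrite /F; case: (leP (t + 1) lambda) => t1.
    rewrite ifT; last lra.
    rewrite ler0_norm; last lra.
    have -> : - (t - lambda) = (lambda - (t + 1)) + 1 by lra.
    have -> : lambda - t = (lambda - (t + 1)) + 1 by lra.
    rewrite rS; have := powR_ge0 rho (lambda - (t + 1)).
    set y := rho `^ _ => y0.
    have : 0 <= y * ((1 - rho) * (1 - rho)) by rewrite mulr_ge0// mulr_ge0//; lra.
    lra.
  case: (leP t lambda) => t2.
    rewrite ler0_norm; last lra.
    have -> : - (t - lambda) = lambda - t by lra.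
    have E : rho `^ (lambda - t) * rho `^ (t + 1 - lambda) = rho.
      rewrite -powRD ?(gt_eqF r0) ?implybT//.
      have -> : lambda - t + (t + 1 - lambda) = 1 by lra.
      by rewrite powRr1// ltW.
    have x1 : rho `^ (lambda - t) <= 1 by rewrite powR_le1//; lra.
    have y1 : rho `^ (t + 1 - lambda) <= 1 by rewrite powR_le1//; lra.
    (* With x y = rho the claim x (1 - rho) <= 2 - y - x becomes (1 - x) (2 - y (1 + x)) >= 0. *)
    move: E x1 y1 (powR_ge0 rho (lambda - t)) (powR_ge0 rho (t + 1 - lambda)).
    set x := rho `^ (lambda - t); set y := rho `^ (t + 1 - lambda) => E x1 y1 x0 y0.
    nra.
  rewrite gtr0_norm; last lra.
  have -> : t + 1 - lambda = (t - lambda) + 1 by lra.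
  by rewrite rS; lra.
have : \sum_(0 <= j < N) rho `^ `|j%:R - lambda| * (1 - rho) <= F N%:R - F 0.
  have <- := telescope_sumr (fun j => F j%:R) (leq0n N).
  by apply: ler_sum => j _; rewrite -natr1; exact: step.
rewrite -mulr_suml => h; rewrite ler_pdivlMr; last lra.
have := F02 N%:R; have := F02 0; lra.
Qed.

(** For finite q the q-th powers decay geometrically on both sides with ratio rho^q, and the bound
    on their sum is independent of the peak lambda. *)
Lemma nat_lp_geometric q rho : (0 < q)%E -> 0 < rho < 1 ->
  exists2 K : R, 0 < K & forall lambda X (a : nat -> \bar R), 0 < X ->
    (forall j, 0 <= a j <= (X * rho `^ `|j%:R - lambda|)%:E)%E ->
    (nat_lp q a <= (K * X)%:E)%E.
Proof.
move=> q0 hr; have /andP[r0 r1] := hr.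
case: q q0 => [r| |//] q0 /=; last first.
  exists 1 => // lambda X a X0 ha; apply: ge_ereal_sup => _ [j _ <-].
  have /andP[_ h] := ha j; apply: le_trans h _.
  by rewrite lee_fin mul1r ler_piMr ?(ltW X0)// powR_le1.
rewrite lte_fin in q0; pose rho' := rho `^ r.
have hr' : 0 < rho' < 1.
  rewrite powR_gt0//=; apply: (@lt_le_trans _ _ (1 `^ r)); last by rewrite powR1.
  by rewrite gt0_ltr_powR ?nnegrE// ltW.
have K0 : 0 < 2 / (1 - rho') by rewrite divr_gt0//; lra.
exists ((2 / (1 - rho')) `^ r^-1); first by rewrite powR_gt0.
move=> lambda X a X0 ha.
have -> : ((2 / (1 - rho')) `^ r^-1 * X)%:E = ((2 / (1 - rho') * X `^ r)%:E `^ r^-1)%E.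
  rewrite poweR_EFin [in RHS]powRM ?powR_ge0 ?(ltW K0)// -powRrM divff ?gt_eqF// powRr1//.
  exact: ltW.
apply: lee_poweR2r; rewrite ?invr_ge0 ?(ltW q0)//.
  by apply: nneseries_ge0 => j _ _; exact: poweR_ge0.
apply: (lime_le (is_cvg_nneseries _)); first by move=> j _ _; exact: poweR_ge0.
apply: nearW => N.
apply: (@le_trans _ _ (\sum_(0 <= j < N) (X `^ r * rho' `^ `|j%:R - lambda|)%:E)%E).
  apply: lee_sum => j _; have /andP[a0 aX] := ha j.
  apply: le_trans (lee_poweR2r (ltW q0) a0 aX) _.
  have -> : rho' `^ `|j%:R - lambda| = (rho `^ `|j%:R - lambda|) `^ r.
    by rewrite -!powRrM mulrC.
  by rewrite lee_fin (powRM _ (ltW X0) (powR_ge0 _ _)).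
rewrite sumEFin lee_fin -mulr_sumr mulrC ler_wpM2r ?powR_ge0//.
exact: two_sided_geometric.
Qed.

(** The two bounds agree at j = lambda, where A = B 2^(lambda (d + e)); their common value there is
    the product of powers in the conclusion. Away from lambda the smaller bound decays at least like
    2^(- min(d, e) |j - lambda|). *)
Lemma nat_lp_interpolation q d e : (0 < q)%E -> 0 < d -> 0 < e ->
  exists2 K : R, 0 < K & forall A B (a : nat -> \bar R), 0 <= A -> 0 <= B ->
    (forall j, 0 <= a j)%E ->
    (forall j, a j <= (2 `^ (- (j%:R * d)) * A)%:E)%E ->
    (forall j, a j <= (2 `^ (j%:R * e) * B)%:E)%E ->
    (nat_lp q a <= (K * (A `^ (e / (d + e)) * B `^ (d / (d + e))))%:E)%E.
Proof.
move=> q0 d0 e0; have de0 : 0 < d + e by rewrite addr_gt0.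
pose m := Num.min d e; have m0 : 0 < m by rewrite lt_min d0.
have [|K K0 hK] := @nat_lp_geometric q (2 `^ (- m)) q0.
  rewrite powR_gt0//= powRN invf_lt1 ?powR_gt0//.
  by rewrite /powR pnatr_eq0/= expR_gt1 mulr_gt0// ln_gt0// ltr1n.
exists K => // A B a A0 B0 a0 aA aB.
(* If A or B is 0, all terms vanish and lambda would be undefined. *)
have [AB|] := boolP ((A == 0) || (B == 0)).
  rewrite (lp_eq0 summation_nat)//.
    by rewrite lee_fin !mulr_ge0 ?powR_ge0// ltW.
  move=> j; apply/eqP; rewrite eq_le a0 andbT.
  case/orP: AB => /eqP E; [move: (aA j)|move: (aB j)]; by rewrite E mulr0.
rewrite negb_or => /andP[AN0 BN0].
have {AN0}A0 : 0 < A by rewrite lt_neqAle eq_sym AN0.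
have {BN0}B0 : 0 < B by rewrite lt_neqAle eq_sym BN0.
pose lambda := ln (A / B) / ((d + e) * ln 2).
have ln20 : 0 < ln 2 :> R by rewrite ln_gt0// ltr1n.
have AE : A = B * 2 `^ (lambda * (d + e)).
  rewrite /powR pnatr_eq0/= /lambda.
  have -> : ln (A / B) / ((d + e) * ln 2) * (d + e) * ln 2 = ln (A / B).
    by field; rewrite !gt_eqF.
  by rewrite lnK ?posrE ?divr_gt0// mulrC divfK// gt_eqF.
have p2D (x y : R) : 2 `^ (x + y) = 2 `^ x * 2 `^ y :> R.
  by rewrite powRD// pnatr_eq0 implybT.
have XE : A `^ (e / (d + e)) * B `^ (d / (d + e)) = B * 2 `^ (lambda * e).
  rewrite AE powRM ?powR_ge0 ?(ltW B0)// -powRrM mulrAC.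
  rewrite -powRD ?(gt_eqF B0) ?implybT// -mulrDl [e + d]addrC divff ?gt_eqF//.
  rewrite powRr1 ?(ltW B0)//; congr (_ * 2 `^ _); field; by rewrite gt_eqF.
apply: (hK lambda) => [|j]; first by rewrite mulr_gt0 ?powR_gt0.
rewrite a0 XE -powRrM/=; have [lj|jl] := leP lambda j%:R.
  apply: le_trans (aA j) _; rewrite lee_fin {1}AE ger0_norm ?subr_ge0//.
  rewrite mulrCA -mulrA ler_pM2l// -!p2D ler_powR ?ler1n//.
  have : m * (j%:R - lambda) <= d * (j%:R - lambda).
    by rewrite ler_wpM2r ?subr_ge0// ge_min lexx.
  lra.
apply: le_trans (aB j) _; rewrite lee_fin ltr0_norm ?subr_lt0//.
rewrite mulrC -mulrA ler_pM2l// -!p2D ler_powR ?ler1n//.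
have : m * (lambda - j%:R) <= e * (lambda - j%:R).
  by rewrite ler_wpM2r ?subr_ge0 ?(ltW jl)// ge_min lexx orbT.
lra.
Qed.

End interpolation.

(** * Embeddings of the f-spaces *)

Section f_embedding.
Context {R : realType} (delta : R) (zeta : nat -> int -> R) (n : nat).
Hypothesis hzeta : forall j, hermite_zeros (level_size delta j) (zeta j).
Hypothesis hdelta : 0 < delta < 37^-1.
Variable w : Rn R n -> R.
Hypothesis hw : weight w.
Local Notation level := (level_index delta n).
Local Notation mu := (lebesgue_Rn n).
Implicit Types (s : tile_seq delta n) (q : \bar R) (alpha p : R).

Lemma indic_coef_ge0 s j (nu : level j) x :
  0 <= \1_(tile zeta nu) x * coef zeta s nu.
Proof. by rewrite mulr_ge0// coef_ge0. Qed.

Lemma level_lp_ge0 q s j x :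
  (0 <= fin_lp q (fun nu : level j => (\1_(tile zeta nu) x * coef zeta s nu)%:E))%E.
Proof.
by apply: (lp_ge0 (summation_fin _)) => nu; rewrite lee_fin indic_coef_ge0.
Qed.

Lemma level_term_le_f_fun alpha q s j (nu : level j) x : (0 < q)%E ->
  ((2 `^ (j%:R * alpha) * (\1_(tile zeta nu) x * coef zeta s nu))%:E <=
   f_fun zeta alpha q s x)%E.
Proof.
move=> q0; rewrite f_funE//.
apply: le_trans (lp_ge summation_nat j q0 _); last first.
  by move=> k; rewrite mule_ge0 ?lee_fin ?powR_ge0// level_lp_ge0.
rewrite EFinM lee_wpmul2l ?lee_fin ?powR_ge0//.
apply: le_trans (lp_ge (summation_fin _) nu q0 _) => // k.
by rewrite lee_fin indic_coef_ge0.
Qed.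

(** By [tile_overlap] at most 4^n terms of a level are nonzero at x. *)
Lemma level_lp_le q s j x (t : R) : (0 < q)%E -> 0 <= t ->
  (forall nu : level j, \1_(tile zeta nu) x * coef zeta s nu <= t) ->
  (fin_lp q (fun nu : level j => (\1_(tile zeta nu) x * coef zeta s nu)%:E) <=
   ((4 ^ n)%:R `^ inv_exponent q * t)%:E)%E.
Proof.
move=> q0 t0 ht; case: q q0 => [r| |//] q0 /=; last first.
  by rewrite powRr0 mul1r; apply: bigmax_le => // nu _; rewrite lee_fin.
rewrite lte_fin in q0.
have -> : (((4 ^ n)%:R `^ r^-1 * t)%:E = ((4 ^ n)%:R * t `^ r)%:E `^ r^-1)%E.
  rewrite poweR_EFin [in RHS]powRM ?powR_ge0// -powRrM divff ?gt_eqF// powRr1//.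
apply: lee_poweR2r; rewrite ?invr_ge0 ?(ltW q0)//.
  by apply: sume_ge0 => nu _; rewrite lee_fin powR_ge0.
rewrite sumEFin lee_fin.
apply: (@le_trans _ _ (\sum_(nu in [set nu : level j | `[<tile zeta nu x>]]%SET) t `^ r)).
  rewrite [leRHS]big_mkcond/=; apply: ler_sum => nu _; rewrite inE.
  have [hx|hx] := pselect (tile zeta nu x).
    rewrite asboolT// ge0_ler_powR ?nnegrE ?indic_coef_ge0// ltW//.
  rewrite asboolF// indicE memNset// mul0r powR0// gt_eqF//.
rewrite sumr_const -[leLHS]mulr_natl ler_wpM2r ?powR_ge0// ler_nat.
exact: tile_overlap.
Qed.

Lemma f_fun_antimono alpha q1 q2 s x : (0 < q2)%E -> (q2 <= q1)%E ->
  (f_fun zeta alpha q1 s x <= f_fun zeta alpha q2 s x)%E.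
Proof.
move=> q20 q21; have q10 : (0 < q1)%E := lt_le_trans q20 q21.
have p0 j : (0 <= (2 `^ (j%:R * alpha))%:E :> \bar R)%E by rewrite lee_fin powR_ge0.
rewrite !f_funE//.
apply: le_trans (lp_antimono summation_nat q20 q21 _) _.
  by move=> j; rewrite mule_ge0// level_lp_ge0.
apply: (lp_le summation_nat) => // j; first by rewrite mule_ge0// level_lp_ge0.
rewrite lee_wpmul2l//; apply: (lp_antimono (summation_fin _)) => // nu.
by rewrite lee_fin indic_coef_ge0.
Qed.

Lemma le_f_norm_integral (f g : Rn R n -> \bar R) p (C : \bar R) : 0 < p -> (0 <= C)%E ->
  measurable_fun setT f -> measurable_fun setT g ->
  (forall x, 0 <= g x)%E ->
  (forall x, f x `^ p <= C * g x)%E ->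
  (\int[mu]_x (f x `^ p * (w x)%:E) <= C * \int[mu]_x (g x * (w x)%:E))%E.
Proof.
move=> p0 C0 mf mg g0 fg; have [_ w0 _] := hw.
have mgw : measurable_fun setT (fun x => g x * (w x)%:E)%E.
  by apply: emeasurable_funM => //; exact: measurable_weight.
rewrite -ge0_integralZl//; last by move=> x _; rewrite mule_ge0// lee_fin.
apply: ge0_le_integral => //.
- by move=> x _; rewrite mule_ge0 ?poweR_ge0// lee_fin.
- exact: measurable_f_integrand.
- exact: emeasurable_funM.
- by move=> x _; rewrite muleA lee_wpmul2r ?lee_fin.
Qed.

Lemma f_embeds_same (alpha p : R) (q1 q2 : \bar R) :
  0 < p -> (0 < q2)%E -> (q2 <= q1)%E ->
  embeds (f_norm delta zeta w alpha p q2) (f_norm delta zeta w alpha p q1).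
Proof.
move=> p0 q20 q21; have q10 : (0 < q1)%E := lt_le_trans q20 q21.
exists 1 => // s _; rewrite mul1e /f_norm.
have [_ w0 _] := hw.
apply: lee_poweR2r; rewrite ?invr_ge0 ?(ltW p0)//.
  by apply: integral_ge0 => x _; rewrite mule_ge0 ?poweR_ge0// lee_fin.
rewrite -[leRHS]mul1e; apply: le_f_norm_integral => //.
- exact: measurable_f_fun.
- apply: (measurableT_comp (measurable_poweR _)); exact: measurable_f_fun.
- by move=> x; exact: poweR_ge0.
- move=> x; rewrite mul1e; apply: lee_poweR2r; rewrite ?(ltW p0) ?f_fun_ge0//.
  exact: f_fun_antimono.
Qed.

(** The left side is the weighted L^p norm of one multiple of a tile indicator, which lies pointwise
    below the integrand of the f-norm. *)
Lemma level_term_le_f_norm alpha p q s j (nu : level j) : 0 < p -> (0 < q)%E ->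
  ((2 `^ (j%:R * alpha) * coef zeta s nu)%:E * mass_root p%:E (wmass w (tile zeta nu)) <=
   f_norm delta zeta w alpha p q s)%E.
Proof.
move=> p0 q0; set c := 2 `^ _ * _; have c0 : 0 <= c by rewrite mulr_ge0 ?powR_ge0 ?coef_ge0.
have -> : (c%:E * mass_root p%:E (wmass w (tile zeta nu)) =
    (\int[mu]_x ((c * \1_(tile zeta nu) x)%:E `^ p * (w x)%:E)) `^ p^-1)%E.
  rewrite (integral_weight_indic hw)//; last exact: measurable_tile.
  rewrite poweRM ?wmass_ge0 ?lee_fin ?powR_ge0// poweR_EFin -powRrM divff ?gt_eqF//.
  by rewrite powRr1.
have [_ w0 _] := hw.
apply: lee_poweR2r; rewrite ?invr_ge0 ?(ltW p0)//.
  by apply: integral_ge0 => x _; rewrite mule_ge0 ?poweR_ge0// lee_fin.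
rewrite -[leRHS]mul1e; apply: le_f_norm_integral => //.
- apply/measurable_EFinP; apply: measurable_funM => //.
  by apply: measurable_indic; exact: measurable_tile.
- apply: (measurableT_comp (measurable_poweR _)); exact: measurable_f_fun.
- by move=> x; exact: poweR_ge0.
- move=> x; rewrite mul1e; apply: lee_poweR2r; rewrite ?(ltW p0)//.
    by rewrite lee_fin mulr_ge0.
  by rewrite /c -mulrA [_ * \1_ _ _]mulrC; exact: level_term_le_f_fun.
Qed.

End f_embedding.

(** * Pointwise interpolation and the embedding for alpha1 < alpha2 *)

Section f_embedding.
Context {R : realType} (delta : R) (zeta : nat -> int -> R) (n : nat).
Hypothesis hzeta : forall j, hermite_zeros (level_size delta j) (zeta j).
Hypothesis hdelta : 0 < delta < 37^-1.
Variable w : Rn R n -> R.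
Hypothesis hw : weight w.
Local Notation level := (level_index delta n).
Local Notation mu := (lebesgue_Rn n).

(* A pointwise interpolation between the value of the source function at x,
   good for large j, and its norm, good for small j. *)
Lemma f_fun_pointwise (alpha1 alpha2 e : R) (q1 q2 : \bar R) :
  (0 < q1)%E -> (0 < q2)%E -> alpha1 < alpha2 -> 0 < e ->
  exists2 K : R, 0 < K &
    forall (s : tile_seq delta n) (B : R), 0 <= B ->
    (forall j (nu : level j),
      2 `^ (j%:R * alpha1) * coef zeta s nu <= 2 `^ (j%:R * e) * B) ->
    forall x, (f_fun zeta alpha1 q1 s x <=
      (K * B `^ ((alpha2 - alpha1) / (alpha2 - alpha1 + e)))%:E *
      f_fun zeta alpha2 q2 s x `^ (e / (alpha2 - alpha1 + e)))%E.
Proof.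
move=> q10 q20 a12 e0; set d := alpha2 - alpha1; have d0 : 0 < d by rewrite subr_gt0.
have de0 : 0 < d + e by rewrite addr_gt0.
have [K K0 hK] := nat_lp_interpolation q10 d0 e0.
pose M : R := (4 ^ n)%:R `^ inv_exponent q1.
have M0 : 0 < M by rewrite powR_gt0// ltr0n expn_gt0.
have p2D (x y : R) : 2 `^ (x + y) = 2 `^ x * 2 `^ y :> R.
  by rewrite powRD// pnatr_eq0 implybT.
exists (K * M); first by rewrite mulr_gt0.
move=> s B B0 hB x.
(* Here A is any finite bound for the source terms at x; it is taken to be the value of the source
   function, or 0 when that value is infinite and B = 0. *)
have aux (A : R) : 0 <= A ->
    (forall j (nu : level j), 2 `^ (j%:R * alpha2) *
       (\1_(tile zeta nu) x * coef zeta s nu) <= A) ->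
    (f_fun zeta alpha1 q1 s x <= (K * M * B `^ (d / (d + e)) * A `^ (e / (d + e)))%:E)%E.
  move=> A0 hA; rewrite f_funE//.
  have -> : K * M * B `^ (d / (d + e)) * A `^ (e / (d + e)) =
      K * ((M * A) `^ (e / (d + e)) * (M * B) `^ (d / (d + e))).
    rewrite !powRM ?(ltW M0)// [X in _ = K * X]mulrACA -powRD; last first.
      by rewrite (gt_eqF M0) implybT.
    rewrite -mulrDl [e + d]addrC divff ?gt_eqF// powRr1 ?(ltW M0)//.
    ring.
  have bound (t : R) j : 0 <= t -> (forall nu : level j,
      2 `^ (j%:R * alpha1) * (\1_(tile zeta nu) x * coef zeta s nu) <= t) ->
      ((2 `^ (j%:R * alpha1))%:E * fin_lp q1 (fun nu : level j =>
        (\1_(tile zeta nu) x * coef zeta s nu)%:E) <= (M * t)%:E)%E.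
    move=> t0 ht; have pj : 0 < 2 `^ (j%:R * alpha1) :> R by rewrite powR_gt0.
    rewrite -lee_pdivlMl//.
    apply: le_trans
      (level_lp_le hzeta (t := t / 2 `^ (j%:R * alpha1)) q10 _ _) _.
    - by rewrite divr_ge0// ltW.
    - by move=> nu; rewrite ler_pdivlMr// mulrC.
    - by rewrite -EFinM lee_fin -/M mulrA [leLHS]mulrC.
  apply: hK.
  - by rewrite mulr_ge0// ltW.
  - by rewrite mulr_ge0// ltW.
  - by move=> j; rewrite mule_ge0 ?lee_fin ?powR_ge0// level_lp_ge0.
  - move=> j; rewrite mulrCA; apply: bound => [|nu]; first by rewrite mulr_ge0 ?powR_ge0.
    apply: le_trans (_ : 2 `^ (- (j%:R * d)) * (2 `^ (j%:R * alpha2) *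
       (\1_(tile zeta nu) x * coef zeta s nu)) <= _); last by rewrite ler_wpM2l ?powR_ge0.
    rewrite [leRHS]mulrA -p2D /d.
    by have -> : - (j%:R * (alpha2 - alpha1)) + j%:R * alpha2 =
      j%:R * alpha1 by ring.
  - move=> j; rewrite mulrCA; apply: bound => [|nu]; first by rewrite mulr_ge0 ?powR_ge0.
    apply: le_trans (hB j nu); rewrite ler_wpM2l ?powR_ge0//.
    by rewrite ler_piMl ?coef_ge0// indicE; case: (_ \in _).
have g_ge j (nu : level j) := level_term_le_f_fun zeta alpha2 s nu x q20.
move: g_ge (f_fun_ge0 zeta alpha2 s x q20).
case: (f_fun zeta alpha2 q2 s x) => [A g_ge A0|_ _|//].
  rewrite poweR_EFin -EFinM; exact: aux.
(* At an infinite source value the right side is infinite for B > 0. For B = 0 it is 0 times oo,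
   that is 0, but then all coefficients vanish. *)
have [B_gt0|B_le0] := ltP 0 B.
  rewrite poweRyr ?gt_eqF ?divr_gt0// gt0_muley ?leey//.
  by rewrite lte_fin !mulr_gt0// powR_gt0.
have BE : B = 0 by apply/eqP; rewrite eq_le B_le0.
apply: le_trans (aux 0 (lexx _) _) _.
  move=> j nu; have := hB j nu; rewrite BE mulr0 pmulr_rle0 ?powR_gt0// => h.
  by rewrite pmulr_rle0 ?powR_gt0// mulr_ge0_le0.
rewrite BE !powR0 ?mulr0 ?mul0e//; by rewrite gt_eqF// divr_gt0.
Qed.

(** With e = gamma / p1 and d = alpha2 - alpha1 one has d + e = gamma / p2, so the interpolation
    exponents are p2 / p1 and 1 - p2 / p1. Raising the pointwise bound to the power p1 leaves the
    source function to the power p2, which integrates to the source norm. *)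
Lemma f_embeds_of_tile_lower_bound (gamma alpha1 alpha2 p1 p2 : R) (q1 q2 : \bar R) :
  0 < gamma -> alpha1 < alpha2 ->
  0 < p1 -> 0 < p2 -> (0 < q1)%E -> (0 < q2)%E ->
  alpha1 - gamma / p1 = alpha2 - gamma / p2 ->
  tile_lower_bound delta zeta w gamma ->
  embeds (f_norm delta zeta w alpha2 p2 q2) (f_norm delta zeta w alpha1 p1 q1).
Proof.
move=> g0 a12 p10 p20 q10 q20 aE [c c0 hc].
set d := alpha2 - alpha1; have d0 : 0 < d by rewrite subr_gt0.
pose e := gamma / p1; have e0 : 0 < e by rewrite divr_gt0.
have deE : d + e = gamma / p2 by rewrite /d /e; lra.
have [K K0 hK] := f_fun_pointwise q10 q20 a12 e0.
have tE : e / (d + e) = p2 / p1.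
  by rewrite deE /e; field; rewrite !gt_eqF.
have tE' : d / (d + e) = 1 - p2 / p1.
  by rewrite -tE; field; rewrite gt_eqF// addr_gt0.
rewrite -/d tE tE' in hK.
pose b := c `^ (- p2^-1); have b0 : 0 < b by rewrite powR_gt0.
have p21 : 0 < p2 / p1 by rewrite divr_gt0.
have t1 : 0 < 1 - p2 / p1 by rewrite -tE' divr_gt0// addr_gt0.
exists (K * b `^ (1 - p2 / p1)); first by rewrite mulr_gt0// powR_gt0.
move=> s Goo; have [_ w0 _] := hw.
have G0 : (0 <= f_norm delta zeta w alpha2 p2 q2 s)%E by exact: poweR_ge0.
have GI : (\int[mu]_x (f_fun zeta alpha2 q2 s x `^ p2 * (w x)%:E) =
    f_norm delta zeta w alpha2 p2 q2 s `^ p2)%E.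
  rewrite /f_norm poweRVK ?gt_eqF//.
  by apply: integral_ge0 => x _; rewrite mule_ge0 ?poweR_ge0// lee_fin.
have hterm j (nu : level j) := level_term_le_f_norm zeta hw alpha2 s nu p20 q20.
move: Goo G0 GI hterm; case: (f_norm delta zeta w alpha2 p2 q2 s) => [G| |//] // _ G0 GI hterm.
rewrite lee_fin in G0.
have p2D (x y : R) : 2 `^ (x + y) = 2 `^ x * 2 `^ y :> R.
  by rewrite powRD// pnatr_eq0 implybT.
(* The mass bound gives w(R)^(1/p2) >= c^(1/p2) 2^(- j gamma / p2). Dividing the single-tile
   estimate by it produces the constant b, and alpha1 = alpha2 - gamma / p2 + e. *)
have hB j (nu : level j) :
    2 `^ (j%:R * alpha1) * coef zeta s nu <= 2 `^ (j%:R * e) * (b * G).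
  have := hterm j nu; have := hc j nu.
  rewrite (wmass_tileE hzeta hdelta hw) mass_root_fin -EFinM !lee_fin/=.
  set m := fine _ => cm hG.
  have cj0 : 0 < c * 2 `^ (- (j%:R * gamma)) by rewrite mulr_gt0 ?powR_gt0.
  have m0 : 0 < m := lt_le_trans cj0 cm.
  have mp : (c * 2 `^ (- (j%:R * gamma))) `^ p2^-1 <= m `^ p2^-1.
    by rewrite ge0_ler_powR ?nnegrE ?(ltW m0) ?(ltW cj0) ?invr_ge0 ?(ltW p20).
  rewrite powRM ?powR_ge0 ?(ltW c0)// -powRrM in mp.
  have h1 : 2 `^ (j%:R * alpha2) * coef zeta s nu *
      (c `^ p2^-1 * 2 `^ (- (j%:R * gamma) * p2^-1)) <= G.
    by apply: le_trans hG; rewrite ler_wpM2l// mulr_ge0 ?powR_ge0// coef_ge0.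
  have -> : 2 `^ (j%:R * alpha1) * coef zeta s nu =
    2 `^ (j%:R * e) * b * (2 `^ (j%:R * alpha2) * coef zeta s nu *
      (c `^ p2^-1 * 2 `^ (- (j%:R * gamma) * p2^-1))).
    have bc : b * c `^ p2^-1 = 1 by rewrite /b powRN mulVf// gt_eqF// powR_gt0.
    have -> : j%:R * alpha1 = j%:R * e + (j%:R * alpha2 + (- (j%:R * gamma) * p2^-1)).
      have -> : alpha1 = alpha2 - gamma / p2 + e by rewrite /e; lra.
      ring.
    rewrite !p2D; set X := 2 `^ (j%:R * e); set Y := 2 `^ (j%:R * alpha2).
    set Z := 2 `^ (- (j%:R * gamma) * p2^-1).
    transitivity (X * (Y * Z) * coef zeta s nu * (b * c `^ p2^-1)); last by ring.
    by rewrite bc mulr1.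
  by rewrite [leRHS]mulrA ler_wpM2l// mulr_ge0 ?powR_ge0// ltW.
have hx := hK s (b * G) (mulr_ge0 (ltW b0) G0) hB.
set D := K * (b * G) `^ (1 - p2 / p1) in hx.
have D0 : 0 <= D by rewrite mulr_ge0 ?powR_ge0// ltW.
have hx' x : (f_fun zeta alpha1 q1 s x `^ p1 <=
    (D `^ p1)%:E * f_fun zeta alpha2 q2 s x `^ p2)%E.
  apply: le_trans (lee_poweR2r (ltW p10) (f_fun_ge0 zeta alpha1 s x q10) (hx x)) _.
  rewrite poweRM ?poweR_ge0 ?lee_fin// poweR_EFin -poweRrM divfK ?gt_eqF//.
have mf2 : measurable_fun setT (fun x => f_fun zeta alpha2 q2 s x `^ p2)%E.
  by apply: (measurableT_comp (measurable_poweR _)); exact: measurable_f_fun.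
have hI := le_f_norm_integral hw p10 (_ : 0 <= (D `^ p1)%:E)%E
  (measurable_f_fun zeta alpha1 s q10) mf2 (fun x => poweR_ge0 _ _) hx'.
(* The powers of G recombine: G^(1 - p2/p1) from D and G^(p2/p1) from the integral. *)
have -> : ((K * b `^ (1 - p2 / p1))%:E * G%:E = ((D `^ p1)%:E * G%:E `^ p2) `^ p1^-1)%E.
  rewrite poweR_EFin -!EFinM poweR_EFin; congr EFin.
  rewrite [in RHS]powRM ?powR_ge0// -[(D `^ _) `^ _]powRrM -[(G `^ _) `^ _]powRrM.
  rewrite divff ?gt_eqF// powRr1//.
  rewrite /D powRM ?(ltW b0)// -!mulrA; congr (_ * (_ * _)).
  rewrite -powRD; first by rewrite subrK powRr1.
  by rewrite subrK oner_eq0.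
apply: lee_poweR2r; rewrite ?invr_ge0 ?(ltW p10)//.
  by apply: integral_ge0 => x _; rewrite mule_ge0 ?poweR_ge0// lee_fin.
by rewrite -GI; apply: hI; rewrite lee_fin powR_ge0.
Qed.

End f_embedding.

(* The necessity halves exclude alpha1 = alpha2, where the embedding is the
   identity and carries no information on w, and weights vanishing on a ball;
   the sufficiency half of the second part excludes alpha1 = alpha2 with
   q1 < q2, where it fails for w = 1. *)
Theorem theorem4p1 (R : realType) (delta : R) (hdelta : 0 < delta < 37^-1)
  (zeta : nat -> int -> R)
  (hzeta : forall j, hermite_zeros (level_size delta j) (zeta j))
  (n : nat) (hn : (1 <= n)%N) (gamma : R) (hgamma : 0 < gamma)
  (w : Rn R n -> R) (hw : weight w) :
  (forall (alpha1 alpha2 : R) (p1 p2 q1 q2 : \bar R),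
     alpha1 <= alpha2 ->
     (0 < p1)%E -> (0 < p2)%E -> (0 < q2)%E -> (q2 <= q1)%E ->
     alpha1 - div_exponent gamma p1 = alpha2 - div_exponent gamma p2 ->
     (lower_bound_property gamma w ->
      embeds (b_norm delta zeta w alpha2 p2 q2)
             (b_norm delta zeta w alpha1 p1 q1)) /\
     (alpha1 < alpha2 ->
      p1 = +oo%E \/ (forall x r, 0 < r -> (0 < wmass w (eball x r))%E) ->
      embeds (b_norm delta zeta w alpha2 p2 q2)
             (b_norm delta zeta w alpha1 p1 q1) ->
      lower_bound_property gamma w)) /\
  (Ainfty w ->
   forall (alpha1 alpha2 p1 p2 : R) (q1 q2 : \bar R),
     alpha1 <= alpha2 -> 0 < p1 -> 0 < p2 -> (0 < q1)%E -> (0 < q2)%E ->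
     alpha1 - gamma / p1 = alpha2 - gamma / p2 ->
     (alpha1 < alpha2 \/ (q2 <= q1)%E ->
      lower_bound_property gamma w ->
      embeds (f_norm delta zeta w alpha2 p2 q2)
             (f_norm delta zeta w alpha1 p1 q1)) /\
     (alpha1 < alpha2 ->
      (0 < wmass w setT)%E ->
      embeds (f_norm delta zeta w alpha2 p2 q2)
             (f_norm delta zeta w alpha1 p1 q1) ->
      lower_bound_property gamma w)).
Proof.
have to_lower := @lower_bound_tile R delta zeta n hzeta hdelta w hw gamma.
have of_lower := @tile_lower_bound_ball R delta zeta n hzeta hdelta w hw gamma hgamma.
split=> [alpha1 alpha2 p1 p2 q1 q2 a12 p10 p20 q20 q21 aE|
  hA alpha1 alpha2 p1 p2 q1 q2 a12 p10 p20 q10 q20 aE].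
  split=> [/to_lower hlow|a12' hpos hemb]; first
    exact: (b_embeds_of_tile_lower_bound hzeta hdelta hw hgamma a12 p10 p20 q20 q21 aE).
  apply/of_lower/(tile_lower_bound_of_b_embeds
    hzeta hdelta hw hgamma a12' p10 p20 _ q20 aE _ hemb).
    exact: lt_le_trans q20 q21.
  by case: hpos => [->|hball]; [left|right=> j nu; exact: (wmass_tile_gt0 hzeta)].
split=> [hcase /to_lower hlow|a12' wT hemb].
  have [a12'|a21] := ltP alpha1 alpha2; first
    exact: (f_embeds_of_tile_lower_bound hzeta hdelta hw hgamma a12' p10 p20 q10 q20 aE).
  (* Equal smoothness forces p1 = p2 because gamma > 0, and only monotonicity in q remains. *)
  have aE' : alpha1 = alpha2 by apply/eqP; rewrite eq_le a12 a21.
  have q21 : (q2 <= q1)%E by case: hcase => //; rewrite aE' ltxx.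
  have pE : p1 = p2.
    by apply/invr_inj/(mulfI (lt0r_neq0 hgamma)); move: aE; rewrite aE'; lra.
  by rewrite aE' pE; exact: f_embeds_same.
apply/of_lower/(tile_lower_bound_of_f_embeds
  hzeta hdelta hw hgamma a12' p10 p20 q10 q20 aE _ hemb).
by move=> j nu; apply: (wmass_tile_gt0 hzeta hdelta hw) => x r; exact: ball_mass_gt0.
Qed.
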